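(* Let $\mathcal{H}$ be a separable infinite dimensional complex Hilbert space. Then the subspace of unitary $C_{0}$-semigroups over $\mathcal{H}$ is residual in the space of contractive $C_{0}$-semigroups over $\mathcal{H}$ under the topology of uniform WOT-convergence on compact subsets of $\mathbb{R}_{+}$. Moreover, this subspace is of second category (in the space of contractive $C_{0}$-semigroups with this topology).
   Context: $\mathbb{R}_{+}=[0,\infty)$. A contractive (respectively unitary) $C_{0}$-semigroup over $\mathcal{H}$ is a strongly continuous function $T$ from $\mathbb{R}_{+}$ to the contractions (respectively unitary operators) on $\mathcal{H}$ with $T(0)=I$ and $T(s+t)=T(s)T(t)$ for all $s,t\in\mathbb{R}_{+}$. The topology of uniform WOT-convergence on compact subsets of $\mathbb{R}_{+}$ is defined by: a net $(T_{i})_{i}$ converges to $T$ if and only if for all $\xi,\eta\in\mathcal{H}$ and all compact $K\subseteq\mathbb{R}_{+}$, $\sup_{t\in K}|\langle (T_{i}(t)-T(t))\xi,\eta\rangle|\to 0$. A subset of a topological space is residual (comeagre) if it contains a countable intersection of dense open sets; it is of second category if it is not meagre, i.e. not contained in a countable union of closed sets with empty interior. *)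

(* Defs.v *)
From HB Require Import structures.
From mathcomp Require Import all_boot all_order all_algebra finmap.
From mathcomp Require Import all_classical all_reals all_analysis.
From mathcomp Require Import borel_hierarchy sesquilinear.
From mathcomp Require Export complex.

Set Implicit Arguments.
Unset Strict Implicit.
Unset Printing Implicit Defensive.

Import Order.TTheory GRing.Theory Num.Theory.
Import numFieldNormedType.Exports.

Local Open Scope classical_set_scope.
Local Open Scope ring_scope.
Local Open Scope complex_scope.

(* The norm of a normed module over R[i] takes its values in R[i]
   (nonnegative reals of R[i]). *)
HB.mixin Record NormedModule_isHilbert (R : realType) H
    of CompleteNormedModule R[i] H := {
  inner : {dot H for (@Num.conj R[i])};
  inner_norm : forall x : H, inner x x = `|x| ^+ 2
}.

#[short(type="hilbertType")]
HB.structure Definition Hilbert (R : realType) :=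
  {H of NormedModule_isHilbert R H & CompleteNormedModule R[i] H}.

Definition separable (T : topologicalType) :=
  exists2 D : set T, countable D & dense D.

Definition finite_dimensional (K : fieldType) (V : lmodType K) :=
  exists n (e : 'I_n -> V),
    forall x, exists c : 'I_n -> K, x = \sum_(i < n) c i *: e i.

Definition residual (T : topologicalType) (A : set T) :=
  exists2 G : set T, Gdelta_dense G & G `<=` A.

Definition meagre (T : topologicalType) (A : set T) :=
  exists2 F : (set T)^nat,
    (forall i, closed (F i) /\ interior (F i) = set0) & A `<=` \bigcup_i F i.

Definition second_category (T : topologicalType) (A : set T) := ~ meagre A.

Section NonnegativeReals.
Variable R : realType.

(* With the subspace topology inherited from R. *)
Definition Rplus : Type := set_type [set t : R | 0 <= t].
HB.instance Definition _ := Topological.on Rplus.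

Definition to_Rplus (x : R) (x0 : 0 <= x) : Rplus := exist _ x (mem_set x0).

Definition rplus0 : Rplus := to_Rplus (lexx 0).

Definition rplusD (s t : Rplus) : Rplus :=
  to_Rplus (addr_ge0 (set_valP s) (set_valP t)).

End NonnegativeReals.

Section Semigroups.
Variables (R : realType) (H : hilbertType R).

Definition contraction (f : H -> H) :=
  linear f /\ forall x, `|f x| <= `|x|.

Definition adjoint (f g : H -> H) :=
  forall x y, inner (f x) y = inner x (g y).

Definition unitary (f : H -> H) :=
  linear f /\ exists g, [/\ adjoint f g, cancel f g & cancel g f].

(* Maps H -> H with the uniformity defined by the f |-> <f xi, eta>;
   restricted to bounded operators this is the WOT. *)
Definition wot : Type := initial_topology
  (fun (f : H -> H) =>
    (fun p => inner (f p.1) p.2) : prod_topology (fun _ : H * H => R[i]^o)).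
HB.instance Definition _ := Uniform.on wot.

Lemma wot_entourageP (E : set (wot * wot)) :
  entourage E <->
  exists (F : seq (H * H)) (e : R), 0 < e /\
    [set fg | forall p, p \in F ->
      `|inner (fg.1 p.1) p.2 - inner (fg.2 p.1) p.2| < e%:C] `<=` E.
Proof.
split.
- move=> [V [W [G _ <-] GV] VE].
  have : exists (F : seq (H * H)) (e : R), 0 < e /\
    [set fg | forall p, p \in F ->
      `|inner (fg.1 p.1) p.2 - inner (fg.2 p.1) p.2| < e%:C] `<=`
     [set fg : wot * wot | forall p, p \in (G : seq _) ->
      (projT1 p).2 (fun q => inner (fg.1 q.1) q.2, fun q => inner (fg.2 q.1) q.2)].
    elim: (G : seq _) => [|[[q A] /= qA] s [F [e [e0 IH]]]].
      by exists [::], 1; split.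
    have /asboolP[B + BA] := qA.
    rewrite -entourage_ballE => -[d /= d0 dB].
    have [dR d_eq] : exists d' : R, d = d'%:C.
      exists (complex.Re d); move: d0; case: (d) => a b.
      by rewrite ltcE /= => /andP[/eqP -> _].
    move: d0; rewrite d_eq ltcR => d0.
    exists (q :: F), (Num.min e dR); split; first by rewrite lt_min e0.
    move=> fg /= fgF p; rewrite inE => /orP[/eqP ->|ps] /=.
      apply: BA; apply: dB => /=; rewrite d_eq /ball_ /=.
      apply: lt_le_trans (fgF q (mem_head _ _)) _.
      by rewrite lecR ge_min lexx orbT.
    apply: IH ps => r rF /=; apply: lt_le_trans (fgF r _) _.
      by rewrite inE rF orbT.
    by rewrite lecR ge_min lexx.
  move=> [F [e [e0 FE]]]; exists F, e; split => // fg /FE fgG.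
  by apply: VE; apply: GV => p; exact: fgG.
- move=> [F [e [e0 FE]]]; apply: (@filterS _ _ (@entourage_filter wot) _ _ FE).
  elim: F {FE} => [|q F IH].
    apply: (@filterS _ _ (@entourage_filter wot) setT) => //.
    exact: entourageT.
  have Eq : entourage [set fg : wot * wot |
      `|inner (fg.1 q.1) q.2 - inner (fg.2 q.1) q.2| < e%:C].
    have entB : @entourage R[i]^o [set xy | ball_ Num.norm xy.1 e%:C xy.2].
      by rewrite -entourage_ballE; exists e%:C => //=; rewrite ltcR.
    pose V : set (prod_topology (fun _ : H * H => R[i]^o) *
      prod_topology (fun _ : H * H => R[i]^o)) :=
       [set gh | ball_ Num.norm (gh.1 q) e%:C (gh.2 q)].
    exists V; last by move=> fg.
    have entV : `[< @entourage (initial_topology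
      (@proj _ (fun _ : H * H => R[i]^o) q)) V >].
      by apply/asboolP; eexists; first exact: entB.
    exists V; last by [].
    apply: (@finI_from1 _ _ setT _ (exist _ (q : {classic H * H}, V) entV)).
    exact: I.
  apply: (@filterS _ _ (@entourage_filter wot) _ _ _
    (@filterI _ _ (@entourage_filter wot) _ _ IH Eq)) => fg [/= h1 h2] p.
  by rewrite inE => /orP[/eqP ->|/h1].
Qed.

Definition contractive_C0 (T : Rplus R -> H -> H) :=
  [/\ forall t, contraction (T t),
      T (rplus0 R) = id,
      forall s t, T (rplusD s t) = T s \o T t
    & forall x : H, continuous (fun t => T t x)].

Definition contractive_semigroup : Type :=
  set_type [set T : {family compact, Rplus R -> wot} | contractive_C0 T].
HB.instance Definition _ := Topological.on contractive_semigroup.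

Lemma cvg_contractive_semigroupP (F : set_system contractive_semigroup)
    (T : contractive_semigroup) : Filter F ->
  F --> T <->
  forall (xi eta : H) (K : set (Rplus R)), compact K -> forall e : R, 0 < e ->
    \forall S \near F, forall t, K t ->
      `|inner (set_val S t xi - set_val T t xi) eta| < e%:C.
Proof.
move=> FF.
have -> : (F --> T) <-> {family compact, set_val @ F --> set_val T}.
  split=> [FT|FT].
    apply: cvg_trans
      (@initial_continuous _ {family compact, Rplus R -> wot} set_val T).
    exact: cvg_app.
  move=> A [B [[C oC <-] /= CT CA]]; apply: filterS CA _; apply: FT.
  exact: open_nbhs_nbhs.
rewrite fam_cvgP; split.
- move=> FT xi eta K cK e e0.
  pose B := [set S : {uniform` K -> wot} | forall t, K t ->
    `|inner (S t xi - set_val T t xi) eta| < e%:C].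
  suff /(FT K cK) : nbhs (set_val T : {uniform` K -> wot}) B by [].
  apply/uniform_nbhs.
  exists [set fg : wot * wot |
    `|inner (fg.1 xi) eta - inner (fg.2 xi) eta| < e%:C]; split.
    apply/wot_entourageP; exists [:: (xi, eta)], e; split => // fg.
    exact: (fun h => h (xi, eta) (mem_head _ _)).
  by move=> S /= HS t /HS; rewrite linearBl distrC.
- move=> FT K cK A /uniform_nbhs [E [/wot_entourageP [G [e [e0 GE]]] EA]].
  apply: filterS EA _ => /=.
  have : \forall S \near F, forall p, p \in G -> forall t, K t ->
      `|inner (set_val S t p.1 - set_val T t p.1) p.2| < e%:C.
    elim: G {GE} => [|q G IH]; first exact: nearW.
    apply: filterS (filterI IH (FT q.1 q.2 K cK e e0)) => S [/= h1 h2] p.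
    by rewrite inE => /orP[/eqP ->|/h1].
  apply: filterS => S HS t Kt; apply: GE => p pG /=.
  have := HS p pG t Kt; rewrite linearBl distrC; exact.
Qed.

Definition unitary_semigroups : set contractive_semigroup :=
  [set T | forall t, unitary (set_val T t)].

End Semigroups.

(* Main.v *)
(** Fix a contractive semigroup [T], finitely many vectors [x_i], and a small
    step [h].  The powers of [T(h)] give a positive Toeplitz kernel
    [<T(h)^m x_i, x_j>], hence a truncated trigonometric moment sequence
    [sum_k mu_k^m c_ik conj(c_jk)] with [|mu_k| = 1]; since [H] is infinite
    dimensional the [c_ik] are coordinates of the [x_i] in some orthonormal family
    of [H] itself.  Writing [mu_k = exp(i theta_k)] with [|theta_k| <= pi], the
    diagonal group [exp(i theta_k t / h)] interpolates, and between grid points it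
    moves [x_i] no more than its value at time [h] does, which is little because
    its matrix coefficients at time [h] are those of [T(h)].  So unitary semigroups
    are dense, without passing to a dilation space.

    A contractive semigroup is unitary as soon as its operator at time [1] is, and
    over a dense sequence this is a countable conjunction of weakly open
    conditions, which gives residuality.  For second category, near a unitary
    semigroup the weak and the strong topology agree, so a Baire argument can be
    run inside strongly Cauchy nested neighbourhoods: their limit is again
    unitary. *)

From HB Require Import structures.
Require Import Defs.
From mathcomp Require Import all_boot all_order all_algebra.
From mathcomp Require Import all_classical all_reals all_analysis.
From mathcomp Require Import sesquilinear spectral ring lra.
Import Defs.

Set Implicit Arguments.
Unset Strict Implicit.
Unset Printing Implicit Defensive.

Import Order.TTheory GRing.Theory Num.Theory.
Import numFieldNormedType.Exports.

Local Open Scope ring_scope.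

(** * Inner product spaces and truncated moment sequences *)

Section DotTransport.
Variables (C : numClosedFieldType) (U : lmodType C) (form : {dot U for Num.conj}).
Local Notation "''[' u , v ]" := (form u v).

Lemma dot_conj u v : '[u, v] = ('[v, u])^*.
Proof. by rewrite hermC expr0 mul1r. Qed.

Lemma dotZl a u v : '[a *: u, v] = a * '[u, v].
Proof. exact: (linearZl_LR form v a u). Qed.

Lemma dotZr a u v : '[u, a *: v] = a^* * '[u, v].
Proof. exact: (linearZr_LR form u a v). Qed.

Lemma dotDl u v w : '[u + v, w] = '[u, w] + '[v, w].
Proof. exact: linearDl. Qed.

Lemma dotBl u v w : '[u - v, w] = '[u, w] - '[v, w].
Proof. exact: linearBl. Qed.

Lemma dotDr u v w : '[u, v + w] = '[u, v] + '[u, w].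
Proof. exact: linearDr. Qed.

Lemma dotBr u v w : '[u, v - w] = '[u, v] - '[u, w].
Proof. exact: linearBr. Qed.

(** The choice [z = '[v, v] / 2] gives the usual reflection; any nonzero [z] with [z + z^* =
    '[v, v]] still gives a unitary map. A complex [z] allows [a] to be sent to [b] even when
    ['[a, b]] is not real. *)
Definition householder v z x : U := x - ('[x, v] / z) *: v.

Lemma householder_linear v z : linear (householder v z).
Proof.
move=> a x y; rewrite /householder dotDl dotZl mulrDl scalerDl.
by rewrite scalerBr scalerA mulrA opprD addrACA.
Qed.

Section HouseholderTheory.
Variables (v : U) (z : C).
Hypotheses (z0 : z != 0) (vz : '[v, v] = z + z^*).

Lemma householder_isometry x y :
  '[householder v z x, householder v z y] = '[x, y].
Proof.
have zc0 : z^* != 0 by rewrite conjC_eq0.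
rewrite /householder dotBl !dotBr !dotZl !dotZr vz.
rewrite (dot_conj v y) rmorphM fmorphV /=.
by field; rewrite z0 zc0.
Qed.

Lemma householderK : cancel (householder v z) (householder v z^*).
Proof.
have zc0 : z^* != 0 by rewrite conjC_eq0.
move=> x; rewrite /householder dotBl dotZl vz -addrA -opprD -scalerDl.
rewrite [X in X *: v](_ : _ = 0) ?scale0r ?subr0 //.
by field; rewrite z0 zc0.
Qed.

End HouseholderTheory.

(* Two finite families with the same Gram matrix are conjugate under a product
   of reflections: when the families already agree on [s], the vector
   [a i - b i] is orthogonal to that common part, so the reflection taking
   [a i] to [b i] fixes it. *)
Lemma dot_transport (I : eqType) (a b : I -> U) (s : seq I) :
  {in s &, forall i j, '[a i, a j] = '[b i, b j]} ->
  exists W W' : U -> U,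
    [/\ linear W, forall x y, '[W x, W y] = '[x, y], cancel W W', cancel W' W
      & {in s, forall i, W (a i) = b i}].
Proof.
elim: s => [|i s IH] ab; first by exists id, id; split.
have [|W [W' [Wlin Wiso WK W'K Wab]]] := IH.
  by move=> j k js ks; apply: ab; rewrite inE ?js ?ks orbT.
have [Wai|/eqP Wai] := eqVneq (W (a i)) (b i).
  exists W, W'; split=> // j; rewrite inE => /orP[/eqP-> //|]; exact: Wab.
set v := W (a i) - b i; set z := '[W (a i), v].
have aabb : '[W (a i), W (a i)] = '[b i, b i].
  by rewrite Wiso; apply: ab; rewrite inE eqxx.
(* This uses only that [W (a i)] and [b i] have equal norms. *)
have vz : '[v, v] = z + z^*.
  rewrite -dot_conj /z {1}/v {2}/v {2}/v dotBl dotBr.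
  by rewrite dotBl /v !dotBr aabb; ring.
have vn0 : '[v, v] != 0 by rewrite dnorm_eq0 subr_eq0; exact/eqP.
have z0 : z != 0.
  by apply: contraNneq vn0 => z0; rewrite vz z0 conjC0 addr0.
exists (householder v z \o W), (W' \o householder v z^*); split.
- by move=> k x y /=; rewrite Wlin householder_linear.
- by move=> x y /=; rewrite householder_isometry.
- by move=> x /=; rewrite householderK.
- move=> x /=; rewrite W'K -{1}(conjCK z) householderK ?conjC_eq0 //.
  by rewrite conjCK addrC.
- move=> j; rewrite inE => /orP[/eqP-> |js] /=.
    by rewrite /householder divff // scale1r /v opprB addrC subrK.
  rewrite Wab // /householder [X in X / z](_ : _ = 0) ?mul0r ?scale0r ?subr0 //.
  by rewrite /v dotBr -{1}Wab // Wiso -ab ?subrr // inE ?js ?eqxx ?orbT.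
Qed.

End DotTransport.

(** * Positive kernels as Gram matrices *)

Section GramRealization.
Variable C : numClosedFieldType.

Lemma sum_enum_val (V : nmodType) (I : finType) (F : I -> V) :
  \sum_i F i = \sum_(a < #|I|) F (enum_val a).
Proof. by rewrite (reindex (@enum_val I I)) //; exact/onW_bij/enum_val_bij. Qed.

(** The Hermitian matrix of [G] is unitarily diagonalizable with nonnegative eigenvalues, so it
    factors as [B] times its adjoint, and the rows of [B] are the required vectors. *)
Lemma gram_realization (I : finType) (G : I -> I -> C) :
  (forall i j, G i j = (G j i)^*) ->
  (forall c : I -> C, 0 <= \sum_i \sum_j c i * (c j)^* * G i j) ->
  exists y : I -> 'rV[C]_#|I|, forall i j, dotmx (y i) (y j) = G i j.
Proof.
move=> Gherm Gpos.
pose A := \matrix_(i < #|I|, j < #|I|) G (enum_val i) (enum_val j).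
have At : (A ^t Num.conj)%sesqui = A.
  by apply/matrixP => i j; rewrite !mxE [RHS]Gherm.
have /orthomx_spectralP AE : A \is normalmx by apply/normalmxP; rewrite At.
set P := spectralmx A in AE; set d := spectral_diag A in AE.
have Pu : P \is unitarymx := spectral_unitarymx A.
rewrite invmx_unitary // in AE.
have dE k : d 0 k = (P *m A *m (P ^t Num.conj)%sesqui) k k.
  rewrite AE !mulmxA (unitarymxP Pu) mul1mx -mulmxA (unitarymxP Pu) mulmx1.
  by rewrite mxE eqxx mulr1n.
(* An eigenvalue is the quadratic form of [G] evaluated at a row of [P]. *)
have dpos k : 0 <= d 0 k.
  have := Gpos (fun i => P k (enum_rank i)).
  suff -> : \sum_i \sum_j P k (enum_rank i) * (P k (enum_rank j))^* * G i j =
            d 0 k by [].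
  rewrite dE mxE (sum_enum_val (fun i => \sum_j _)).
  under eq_bigr do rewrite sum_enum_val.
  rewrite exchange_big; apply: eq_bigr => j _.
  rewrite !mxE mulr_suml; apply: eq_bigr => i _.
  by rewrite !enum_valK mxE mulrAC.
pose B := (P ^t Num.conj)%sesqui *m diag_mx (map_mx sqrtC d).
have BE : B *m (B ^t Num.conj)%sesqui = A.
  rewrite AE /B trmx_mul tr_diag_mx map_mxM /= trmxCK map_diag_mx.
  rewrite !mulmxA; congr (_ *m _); rewrite -mulmxA mulmx_diag.
  congr (_ *m diag_mx _); apply/rowP => k.
  by rewrite !mxE /= conj_Creal ?ger0_real ?sqrtC_ge0 // -expr2 sqrtCK.
exists (fun i => row (enum_rank i) B) => i j.
transitivity (A (enum_rank i) (enum_rank j)); last by rewrite mxE !enum_rankK.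
by rewrite -BE dotmxE !mxE; apply: eq_bigr => k _; rewrite !mxE.
Qed.

(* The shift is isometric on vectors realizing the kernel, hence extends to a
   unitary matrix, which is then diagonalized. *)
Lemma toeplitz_moments (I : finType) (M : nat) (tau : nat -> I -> I -> C)
    (G := fun p q : I * 'I_M.+1 =>
       if (q.2 <= p.2)%N then tau (p.2 - q.2)%N p.1 q.1
       else (tau (q.2 - p.2)%N q.1 p.1)^*) :
  (forall i j, tau 0%N i j = (tau 0%N j i)^*) ->
  (forall c : I * 'I_M.+1 -> C,
     0 <= \sum_p \sum_q c p * (c q)^* * G p q) ->
  exists N (mu : 'I_N -> C) (c : I -> 'I_N -> C),
    (forall k, mu k * (mu k)^* = 1) /\
    forall m i j, (m <= M)%N ->
      \sum_k mu k ^+ m * (c i k * (c j k)^*) = tau m i j.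
Proof.
move=> tau0 Gpos.
have Gherm p q : G p q = (G q p)^*.
  rewrite /G; case: (ltngtP q.2 p.2) => [qp|pq|->]; rewrite ?conjCK //.
  by rewrite subnn tau0.
have [y yG] := gram_realization Gherm Gpos.
set N := #|{: I * 'I_M.+1}| in y yG.
(* At the last index [M], [inord] falls back to a default value; hence the shift is used only on
   [s]. *)
pose sh (p : I * 'I_M.+1) := (p.1, inord p.2.+1 : 'I_M.+1).
pose s := [seq p : I * 'I_M.+1 <- enum {: I * 'I_M.+1} | (p.2 < M)%N].
have shE (p : I * 'I_M.+1) : (p.2 < M)%N -> (sh p).2 = p.2.+1 :> nat.
  by move=> pM; rewrite inordK.
have ms (p : I * 'I_M.+1) : (p \in s) = (p.2 < M)%N.
  by rewrite mem_filter mem_enum andbT.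
(* The kernel depends on the second indices only through their difference, so the shift preserves
   it. *)
have Gsh : {in s &, forall p q, dotmx (y p) (y q) = dotmx (y (sh p)) (y (sh q))}.
  move=> p q; rewrite !ms => pM qM.
  by rewrite !yG /G !shE // ltnS !subSS.
have [W [W' [Wlin Wiso WK W'K Wy]]] := dot_transport Gsh.
pose f : {linear 'rV[C]_N -> 'rV[C]_N} :=
  HB.pack W (GRing.isLinear.Build _ _ _ _ W Wlin).
pose V := lin1_mx f.
have VE x : x *m V = W x by rewrite mul_rV_lin1.
have Vu : V \is unitarymx.
  apply/row_unitarymxP => i j; rewrite !rowE !VE Wiso -[LHS]/(dotmx _ _) dotmxE mxE.
  rewrite (bigD1 i) //= big1 ?addr0 => [|k ki]; rewrite !mxE !eqxx /=.
    by rewrite mul1r rmorph_nat eq_sym.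
  by rewrite (negPf ki) mul0r.
have /orthomx_spectralP VP : V \is normalmx.
  apply/normalmxP; rewrite (unitarymxP Vu) -invmx_unitary //.
  by rewrite mulVmx // unitarymx_unit.
set P := spectralmx V in VP; set d := spectral_diag V in VP.
have Pu : P \is unitarymx := spectral_unitarymx V.
rewrite invmx_unitary // in VP.
have dE : diag_mx d = P *m V *m (P ^t Num.conj)%sesqui.
  by rewrite VP !mulmxA (unitarymxP Pu) mul1mx -mulmxA (unitarymxP Pu) mulmx1.
have du : diag_mx d \is unitarymx.
  by rewrite dE !mul_unitarymx // trmxC_unitary.
(* The [mu k] are the eigenvalues of [V], and [c i] lists the coordinates of [y (i, ord0)] in its
   eigenbasis. Since [y (i, inord m)] arises from [y (i, ord0)] by [m] applications of [V], it has
   coordinates [mu k ^+ m * c i k], as long as [m <= M]. *)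
exists N, (fun k => d 0 k), (fun i k => (y (i, ord0) *m (P ^t Num.conj)%sesqui) 0 k).
split=> [k|m i j mM].
  have /unitarymxP := du.
  rewrite tr_diag_mx map_diag_mx mulmx_diag => /matrixP/(_ k k).
  by rewrite !mxE eqxx mulr1n.
have yE : forall k, (y (i, inord m) *m (P ^t Num.conj)%sesqui) 0 k =
    d 0 k ^+ m * (y (i, ord0) *m (P ^t Num.conj)%sesqui) 0 k.
  elim: m mM => [_ k|m IH mM k].
    by rewrite expr0 mul1r; congr ((y (i, _) *m _) _ _); apply/val_inj; rewrite /= inordK.
  have -> : y (i, inord m.+1) = y (i, inord m) *m V.
    have mM1 : (m < M.+1)%N by rewrite ltnS ltnW.
    by rewrite VE Wy ?ms /sh /= inordK.
  rewrite VP !mulmxA -mulmxA (unitarymxP Pu) mulmx1 mul_mx_diag mxE IH ?(ltnW mM) //.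
  by rewrite exprSr mulrAC.
have := yG (i, inord m) (j, ord0).
rewrite /G /= subn0 inordK // => <-.
rewrite dotmxE -(mulmxtVK (y (i, inord m)) (_ : (P ^t Num.conj)%sesqui \is unitarymx)); last first.
  by rewrite trmxC_unitary.
rewrite trmxCK -mulmxA.
have -> : P *m (y (j, ord0) ^t Num.conj)%sesqui =
          ((y (j, ord0) *m (P ^t Num.conj)%sesqui) ^t Num.conj)%sesqui.
  by rewrite trmx_mul map_mxM trmxCK.
rewrite mxE.
by apply: eq_bigr => k _; rewrite yE -mulrA !mxE.
Qed.

End GramRealization.

Local Open Scope classical_set_scope.
Local Open Scope complex_scope.

(** * Hilbert spaces and contractive semigroups *)

Section RealNorm.
Variable R : realType.

(** The norm is a nonnegative element of [R[i]]; its real part carries the same information in [R],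
    where the order is total and [lra] applies. *)
Definition rnorm (V : normedZmodType R[i]) (x : V) : R := complex.Re `|x|.

Lemma rnormE (V : normedZmodType R[i]) (x : V) : `|x| = (rnorm x)%:C.
Proof. by rewrite /rnorm RRe_real ?normr_real. Qed.

Lemma rnorm_ge0 (V : normedZmodType R[i]) (x : V) : 0 <= rnorm x.
Proof. by rewrite -ler0c -rnormE. Qed.

Lemma rnorm0 (V : normedZmodType R[i]) : rnorm (0 : V) = 0.
Proof. by rewrite /rnorm normr0. Qed.

Lemma rnorm_eq0 (V : normedZmodType R[i]) (x : V) : (rnorm x == 0) = (x == 0).
Proof.
apply/eqP/eqP => [x0|->]; last exact: rnorm0.
by apply: normr0_eq0; rewrite rnormE x0.
Qed.

Lemma rnormN (V : normedZmodType R[i]) (x : V) : rnorm (- x) = rnorm x.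
Proof. by rewrite /rnorm normrN. Qed.

Lemma rnormB (V : normedZmodType R[i]) (x y : V) : rnorm (x - y) = rnorm (y - x).
Proof. by rewrite /rnorm distrC. Qed.

Lemma rnormD (V : normedZmodType R[i]) (x y : V) :
  rnorm (x + y) <= rnorm x + rnorm y.
Proof. by rewrite -lecR rmorphD /= -!rnormE ler_normD. Qed.

Lemma rnorm_dist (V : normedZmodType R[i]) (y x z : V) :
  rnorm (x - z) <= rnorm (x - y) + rnorm (y - z).
Proof. by rewrite (le_trans _ (rnormD _ _)) // addrA subrK. Qed.

Lemma rnormZ (V : normedModType R[i]) (a : R[i]) (x : V) :
  rnorm (a *: x) = rnorm a * rnorm x.
Proof. by apply: complexI; rewrite rmorphM /= -!rnormE normrZ. Qed.

Lemma rnormM (a b : R[i]) : rnorm (a * b) = rnorm a * rnorm b.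
Proof. by apply: complexI; rewrite rmorphM /= -!rnormE normrM. Qed.

Lemma conjCE (a : R[i]) : Num.conj a = conjc a.
Proof. by []. Qed.

Lemma Re_le_rnorm (a : R[i]) : complex.Re a <= rnorm a.
Proof.
have := normc_ge_Re a; rewrite rnormE lecR => h.
by apply: le_trans h; rewrite ler_norm.
Qed.

Lemma rnorm_real (a : R) : 0 <= a -> rnorm a%:C = a.
Proof. by move=> a0; rewrite /rnorm ger0_norm // ler0c. Qed.

End RealNorm.

Section InnerProduct.
Variables (R : realType) (H : hilbertType R).
Local Notation "''[' u , v ]" := (inner u v).
Implicit Types x y z : H.

Lemma inner0r x : '[x, 0] = 0.
Proof. exact: linear0r. Qed.

Lemma inner_suml (I : Type) (r : seq I) (P : pred I) (F : I -> H) x :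
  '[\sum_(i <- r | P i) F i, x] = \sum_(i <- r | P i) '[F i, x].
Proof. exact: linear_sumlz. Qed.

Lemma inner_sumr (I : Type) (r : seq I) (P : pred I) (F : I -> H) x :
  '[x, \sum_(i <- r | P i) F i] = \sum_(i <- r | P i) '[x, F i].
Proof. exact: linear_sumr. Qed.

Lemma inner_rnorm x : '[x, x] = (rnorm x ^+ 2)%:C.
Proof. by rewrite inner_norm rnormE rmorphXn. Qed.

Lemma Re_inner_rnorm x : complex.Re '[x, x] = rnorm x ^+ 2.
Proof. by rewrite inner_rnorm. Qed.

Lemma Re_innerC x y : complex.Re '[x, y] = complex.Re '[y, x].
Proof. by rewrite dot_conj; case: '[y, x]. Qed.

Lemma rnorm_sqrB x y :
  rnorm (x - y) ^+ 2 = rnorm x ^+ 2 + rnorm y ^+ 2 - 2 * complex.Re '[x, y].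
Proof.
rewrite -!Re_inner_rnorm dotBl !dotBr !raddfB /= (Re_innerC y x).
by ring.
Qed.

Lemma rnorm_sqrD x y :
  rnorm (x + y) ^+ 2 = rnorm x ^+ 2 + rnorm y ^+ 2 + 2 * complex.Re '[x, y].
Proof.
rewrite -!Re_inner_rnorm dotDl !dotDr !raddfD /= (Re_innerC y x).
by ring.
Qed.

Lemma cauchy_schwarz x y : rnorm '[x, y] <= rnorm x * rnorm y.
Proof.
have [->|y0] := eqVneq y 0; first by rewrite inner0r !rnorm0 mulr0.
have ny : 0 < rnorm y by rewrite lt_neqAle rnorm_ge0 eq_sym rnorm_eq0 y0.
have : 0 <= rnorm (((rnorm y ^+ 2)%:C) *: x - '[x, y] *: y) ^+ 2.
  by rewrite exprn_ge0 ?rnorm_ge0.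
rewrite rnorm_sqrB !rnormZ dotZl dotZr rnorm_real ?exprn_ge0 ?rnorm_ge0 //.
have -> : Num.conj '[x, y] * '[x, y] = (rnorm '[x, y] ^+ 2)%:C.
  by rewrite mulrC -sqr_normc rnormE rmorphXn.
rewrite -rmorphM /= => h.
have := rnorm_ge0 x; have := rnorm_ge0 '[x, y]; move: h.
set a := rnorm '[x, y]; set b := rnorm y; set c := rnorm x => h a0 c0.
have h2 : 0 <= b ^+ 2 * ((c * b) ^+ 2 - a ^+ 2) by move: h; congr (_ <= _); ring.
move: h2; rewrite pmulr_rge0 ?exprn_gt0 // subr_ge0.
by rewrite ler_sqr // nnegrE mulr_ge0 // ltW.
Qed.

End InnerProduct.

Section NonnegativeTimes.
Variable R : realType.
Implicit Types (x y : R) (t : Rplus R).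

(* The absolute value only makes [rp] total; it is used at [0 <= x]. *)
Definition rp x : Rplus R := to_Rplus (normr_ge0 x).

Lemma set_val_rp x : 0 <= x -> set_val (rp x) = x.
Proof. exact: ger0_norm. Qed.

Lemma set_val_ge0 t : 0 <= set_val t.
Proof. exact: (set_valP t). Qed.

Lemma Rplus_inj t t' : set_val t = set_val t' -> t = t'.
Proof. exact: val_inj. Qed.

Lemma rpK t : rp (set_val t) = t.
Proof. by apply: Rplus_inj; rewrite set_val_rp // set_val_ge0. Qed.

Lemma rp0 : rplus0 R = rp 0.
Proof. by apply: Rplus_inj; rewrite set_val_rp. Qed.

Lemma rplusD_rp x y : 0 <= x -> 0 <= y -> rplusD (rp x) (rp y) = rp (x + y).
Proof.
move=> x0 y0; apply: Rplus_inj; rewrite (set_val_rp (addr_ge0 x0 y0)).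
by rewrite -[X in _ = X + _](set_val_rp x0) -[X in _ = _ + X](set_val_rp y0).
Qed.

Lemma rp_continuous : continuous rp.
Proof.
apply: (@continuous_comp_initial _ _ _ (set_val : [set t : R | 0 <= t] -> R)).
exact: norm_continuous.
Qed.

(** Together with [compact_Rplus_bounded], this replaces arbitrary compact sets of times by the
    segments from 0 to [a]. *)
Lemma compact_Rplus_segment x : compact [set t : Rplus R | set_val t <= x].
Proof.
have -> : [set t : Rplus R | set_val t <= x] = rp @` `[0, x].
  apply/seteqP; split => [t /= tx|_ [y /= + <-]].
    by exists (set_val t); rewrite ?rpK //= in_itv /= set_val_ge0.
  by rewrite in_itv /= => /andP[y0 yx]; rewrite set_val_rp.
apply: continuous_compact; last exact: segment_compact.
by apply: continuous_subspaceT; exact: rp_continuous.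
Qed.

Lemma compact_Rplus_bounded (K : set (Rplus R)) :
  compact K -> exists2 a, 0 <= a & forall t, K t -> set_val t <= a.
Proof.
move=> cK; have : compact ((set_val : Rplus R -> R) @` K).
  apply: continuous_compact => //; apply: continuous_subspaceT.
  exact: initial_continuous.
move=> /compact_bounded [M [Mr MK]].
exists (`|M| + 1); first by rewrite addr_ge0.
move=> t Kt; have := MK (`|M| + 1) _ (set_val t).
rewrite (le_lt_trans (ler_norm M)) ?ltrDl // => /(_ isT).
by move=> h; rewrite (le_trans (ler_norm _)) // h //; exists t.
Qed.

End NonnegativeTimes.

Section RealNormTopology.
Variable R : realType.

Lemma cvg_rnormP (V : normedModType R[i]) (T : Type) (F : set_system T)
    (FF : Filter F) (f : T -> V) (l : V) :
  f @ F --> l <->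
  forall e : R, 0 < e -> \forall t \near F, rnorm (f t - l) < e.
Proof.
split=> [/cvgrPdist_lt h e e0|h].
  have := h e%:C; rewrite ltcR => /(_ e0).
  by apply: filterS => t; rewrite rnormE ltcR rnormB.
apply/cvgrPdist_lt => e e0.
have er : e = (complex.Re e)%:C by rewrite RRe_real // ger0_real // ltW.
move: e0; rewrite er ltcR => e0.
by apply: filterS (h _ e0) => t; rewrite rnormE ltcR rnormB.
Qed.

Lemma cauchy_rnorm_cvg (V : completeNormedModType R[i]) (u : nat -> V) :
  (forall e : R, 0 < e -> exists N, forall n, (N <= n)%N -> rnorm (u n - u N) < e) ->
  cvg (u @ \oo).
Proof.
move=> uC; apply/cauchy_cvgP; apply: cauchy_exP => e e0.
have er : e = (complex.Re e)%:C by rewrite RRe_real // ger0_real // ltW.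
move: e0; rewrite er ltcR => /uC [N uN].
exists (u N); exists N => // n /= Nn.
by rewrite -ball_normE /= rnormE ltcR rnormB uN.
Qed.

End RealNormTopology.

Section ContractiveSemigroups.
Variables (R : realType) (H : hilbertType R).
Implicit Types (x y : H) (T : Rplus R -> H -> H) (s t : R).

Lemma contraction_rnorm (f : H -> H) x : contraction f -> rnorm (f x) <= rnorm x.
Proof. by move=> [_ /(_ x)]; rewrite !rnormE lecR. Qed.

Lemma contractionB (f : H -> H) x y : contraction f -> f (x - y) = f x - f y.
Proof. by move=> [flin _]; rewrite addrC -scaleN1r flin scaleN1r addrC. Qed.

Section Theory.
Variable T : Rplus R -> H -> H.
Hypothesis T_C0 : contractive_C0 T.

Lemma C0_contraction t : contraction (T (rp t)).
Proof. by have [] := T_C0. Qed.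

Lemma C0_linear t : linear (T (rp t)).
Proof. exact: (C0_contraction t).1. Qed.

Lemma C0_rnorm t x : rnorm (T (rp t) x) <= rnorm x.
Proof. exact/contraction_rnorm/C0_contraction. Qed.

Lemma C0B t x y : T (rp t) (x - y) = T (rp t) x - T (rp t) y.
Proof. exact/contractionB/C0_contraction. Qed.

Lemma C0_0 x : T (rp 0) x = x.
Proof. by have [_ + _ _] := T_C0; rewrite rp0 => ->. Qed.

Lemma C0D s t x : 0 <= s -> 0 <= t -> T (rp (s + t)) x = T (rp s) (T (rp t) x).
Proof. by move=> s0 t0; have [_ _ TD _] := T_C0; rewrite -rplusD_rp // TD. Qed.

Lemma C0_continuous0 x (e : R) : 0 < e ->
  exists2 h, 0 < h & forall t, 0 <= t -> t <= h -> rnorm (T (rp t) x - x) < e.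
Proof.
move=> e0; have [_ T0 _ Tc] := T_C0.
have Txc : (fun t => T (rp t) x) @ (0 : R) --> T (rp 0) x.
  exact: cvg_comp (@rp_continuous R 0) (Tc x (rp 0)).
move/cvg_rnormP: Txc => /(_ e e0); rewrite C0_0.
move/nbhs_norm0P => [h /= h0 hT].
exists (h / 2); first by rewrite divr_gt0.
move=> t t0 th; apply: hT => /=; rewrite ger0_norm //.
by rewrite (le_lt_trans th) // ltr_pdivrMr // ltr_pMr // ltr1n.
Qed.

(** Factor out the contraction [T (rp s)]. Thus the modulus of continuity of an orbit at time 0 is
    valid at all times. *)
Lemma C0_dist s t x : 0 <= s -> s <= t ->
  rnorm (T (rp t) x - T (rp s) x) <= rnorm (T (rp (t - s)) x - x).
Proof.
move=> s0 st; have -> : T (rp t) x = T (rp s) (T (rp (t - s)) x).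
  by rewrite -C0D ?subr_ge0 // subrKC.
by rewrite -C0B C0_rnorm.
Qed.

End Theory.

(** Strong continuity has to be checked at time 0 only: contractivity and the semigroup law carry it
    to every other time. *)
Lemma contractive_C0_intro T :
  (forall t, 0 <= t -> linear (T (rp t))) ->
  (forall t x, 0 <= t -> rnorm (T (rp t) x) <= rnorm x) ->
  (forall x, T (rp 0) x = x) ->
  (forall s t x, 0 <= s -> 0 <= t -> T (rp (s + t)) x = T (rp s) (T (rp t) x)) ->
  (forall x (e : R), 0 < e -> exists2 h, 0 < h &
     forall t, 0 <= t -> t <= h -> rnorm (T (rp t) x - x) < e) ->
  contractive_C0 T.
Proof.
move=> Tlin Tcontr T0 TD Tcont.
have TB t x y : 0 <= t -> T (rp t) (x - y) = T (rp t) x - T (rp t) y.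
  by move=> t0; rewrite addrC -scaleN1r Tlin // scaleN1r addrC.
have Tdist s t x : 0 <= s -> s <= t ->
    rnorm (T (rp t) x - T (rp s) x) <= rnorm (T (rp (t - s)) x - x).
  move=> s0 st; have -> : T (rp t) x = T (rp s) (T (rp (t - s)) x).
    by rewrite -TD ?subr_ge0 // subrKC.
  by rewrite -TB // Tcontr.
split.
- move=> t; rewrite -(rpK t); split; first exact/Tlin/set_val_ge0.
  by move=> x; rewrite !rnormE lecR Tcontr // set_val_ge0.
- by apply/funext => x; rewrite rp0 T0.
- move=> s t; apply/funext => x /=; rewrite -(rpK s) -(rpK t).
  by rewrite rplusD_rp ?set_val_ge0 // TD // set_val_ge0.
move=> x t; apply/(@cvg_rnormP _ _ _ (nbhs t) (nbhs_filter t)) => e e0.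
have [h h0 hT] := Tcont x e e0.
have : nbhs t ((set_val : Rplus R -> R) @^-1` ball (set_val t : R) h).
  exact: (@initial_continuous _ _ (set_val : [set t : R | 0 <= t] -> R) t _
    (nbhsx_ballx _ _ h0)).
apply: (@filterS _ _ (nbhs_filter t)) => s; rewrite /= -ball_normE /= => sth.
rewrite -(rpK s) -(rpK t); have s0 := set_val_ge0 s; have t0 := set_val_ge0 t.
have [st|ts] := leP (set_val s) (set_val t).
  rewrite rnormB (le_lt_trans (Tdist _ _ _ _ _)) //.
  by rewrite hT ?subr_ge0 // (le_trans (ler_norm _)) // ltW.
rewrite (le_lt_trans (Tdist _ _ _ _ _)) // ?ltW //.
by rewrite hT ?subr_ge0 ?ltW // (le_lt_trans (ler_norm _)) // distrC.
Qed.

End ContractiveSemigroups.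

(** * Approximation by diagonal unitary groups *)

Section UnitComplex.
Variable R : realType.
Implicit Types a b : R.

Definition expi a : R[i] := cos a +i* sin a.

Lemma expi0 : expi 0 = 1.
Proof. by rewrite /expi cos0 sin0. Qed.

Lemma expiD a b : expi (a + b) = expi a * expi b.
Proof.
rewrite /expi cosD sinD; apply/eqP; rewrite eq_complex /= eqxx /=.
by rewrite addrC.
Qed.

Lemma conj_expi a : Num.conj (expi a) = expi (- a).
Proof. by rewrite conjCE /expi cosN sinN. Qed.

Lemma expi_mul_conj a : expi a * Num.conj (expi a) = 1.
Proof. by rewrite conj_expi -expiD subrr expi0. Qed.

Lemma expiMn a n : expi (a *+ n) = expi a ^+ n.
Proof. by elim: n => [|n IH]; rewrite ?mulr0n ?expi0 ?expr0 // mulrS expiD IH exprS. Qed.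

Lemma rnorm_expiB1 a : rnorm (expi a - 1) ^+ 2 = 2 - 2 * cos a.
Proof.
apply: complexI; rewrite rmorphXn /= -rnormE -add_Re2_Im2 /= subr0.
congr (_%:C); rewrite -[X in 2 - _ * X]mulr1 sin2cos2; ring.
Qed.

(** The principal argument is [acos] of the real part, with the sign of the imaginary part. The
    bound by [pi] is what [rnorm_expiB1_le] asks for. *)
Lemma unit_complex_expi (z : R[i]) : z * Num.conj z = 1 ->
  exists2 a, `|a| <= pi & z = expi a.
Proof.
move=> z1; have : `|z| ^+ 2 = 1 by rewrite sqr_normc -conjCE.
rewrite -add_Re2_Im2; case: z {z1} => a b /= /complexI ab.
have a1 : -1 <= a <= 1.
  by rewrite -ler_norml -(@expr_le1 _ 2) // real_normK ?num_real // -ab lerDl sqr_ge0.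
have sqb : Num.sqrt (1 - a ^+ 2) = `|b| by rewrite -ab addrC addKr sqrtr_sqr.
have acos_norm : `|acos a| <= pi by rewrite ger0_norm ?acos_ge0 ?acos_lepi.
have [b0|b0] := leP 0 b.
  by exists (acos a) => //; rewrite /expi acosK // sin_acos // sqb ger0_norm.
exists (- acos a); first by rewrite normrN.
by rewrite /expi cosN sinN acosK // sin_acos // sqb ltr0_norm // opprK.
Qed.

(** The squared distance to 1 is [2 - 2 * cos], and [cos] decreases from 0 to [pi]. This controls
    the interpolating group between grid points. *)
Lemma rnorm_expiB1_le (a s : R) : `|a| <= pi -> 0 <= s <= 1 ->
  rnorm (expi (a * s) - 1) ^+ 2 <= rnorm (expi a - 1) ^+ 2.
Proof.
move=> api /andP[s0 s1]; rewrite !rnorm_expiB1 lerD2l lerN2 ler_pM2l //.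
rewrite -cos_norm -[leRHS]cos_norm normrM (ger0_norm s0).
have as_a : `|a| * s <= `|a| by rewrite ler_piMr.
move: as_a; rewrite le_eqVlt => /orP[/eqP-> //|as_a].
rewrite ltW // ltr_cos // in_itv /= ?normr_ge0 ?api ?mulr_ge0 //=.
by rewrite ltW // (lt_le_trans as_a).
Qed.

End UnitComplex.

Section Orthonormal.
Variables (R : realType) (H : hilbertType R).
Local Notation "''[' u , v ]" := (inner u v).

Lemma exists_orthonormal (N : nat) : ~ finite_dimensional H ->
  exists g : 'I_N -> H, forall i j, '[g i, g j] = (i == j)%:R.
Proof.
move=> Hinf.
(* Gram-Schmidt; indexing by [nat] lets the induction extend the family without changing its index
   type. *)
suff [g gE] : exists g : nat -> H, forall i j, (i < N)%N -> (j < N)%N ->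
    '[g i, g j] = (i == j)%:R.
  by exists g => i j; rewrite gE.
elim: N => [|N [g gE]]; first by exists (fun=> 0).
have [x xg] : exists x, forall c : 'I_N -> R[i], x <> \sum_(i < N) c i *: g i.
  apply: contrapT => h; apply: Hinf; exists N, g => x.
  apply: contrapT => h2; apply: h; exists x => c xc; apply: h2.
  by exists c.
pose r := x - \sum_(i < N) '[x, g i] *: g i.
have r0 : rnorm r != 0.
  rewrite rnorm_eq0 subr_eq0; apply/eqP; exact: xg.
have rg i : (i < N)%N -> '[r, g i] = 0.
  move=> iN; rewrite /r dotBl inner_suml (bigD1 (Ordinal iN)) //= big1.
    by rewrite dotZl gE // eqxx mulr1 addr0 subrr.
  by move=> j ji; rewrite dotZl gE // [_ == _](negPf ji) mulr0.
pose e := ((rnorm r)^-1)%:C *: r.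
have eg i : (i < N)%N -> '[e, g i] = 0.
  by move=> iN; rewrite dotZl rg ?mulr0.
exists (fun i => if (i < N)%N then g i else e) => i j.
rewrite !ltnS => iN jN.
case: (ltnP i N) => iN'; case: (ltnP j N) => jN'.
- exact: gE.
- by rewrite dot_conj eg // conjC0 (ltn_eqF (leq_trans iN' jN')).
- by rewrite eg // eq_sym (ltn_eqF (leq_trans jN' iN')).
- have -> : i = j by apply/eqP; rewrite eqn_leq (leq_trans iN jN') (leq_trans jN iN').
  rewrite eqxx /e dotZl dotZr inner_rnorm conjCE conjc_real.
  by rewrite -!rmorphM /= mulrA -expr2 -exprMn mulVf // expr1n.
Qed.

(** For any orthonormal [g], the vectors with coordinates [c i] have the Gram matrix of [x]. An
    isometry [W] from [dot_transport] sends them to the [x i], and [W \o g] is the wanted family. *)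
Lemma orthonormal_coordinates (I : finType) (N : nat) (x : I -> H)
    (c : I -> 'I_N -> R[i]) :
  ~ finite_dimensional H ->
  (forall i j, \sum_k c i k * Num.conj (c j k) = '[x i, x j]) ->
  exists g : 'I_N -> H, (forall k l, '[g k, g l] = (k == l)%:R) /\
    forall i, x i = \sum_k c i k *: g k.
Proof.
move=> Hinf cx; have [g gE] := exists_orthonormal N Hinf.
have Gram : {in enum I &, forall i j,
    '[\sum_k c i k *: g k, \sum_k c j k *: g k] = '[x i, x j]}.
  move=> i j _ _; rewrite -cx inner_suml; apply: eq_bigr => k _.
  rewrite inner_sumr (bigD1 k) //= big1 ?addr0 => [|l lk].
    by rewrite dotZl dotZr gE eqxx mulr1.
  by rewrite dotZl dotZr gE eq_sym (negPf lk) !mulr0.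
have [W [_ [Wlin Wiso _ _ Wx]]] := dot_transport Gram.
exists (W \o g); split=> [k l|i]; first by rewrite /= Wiso.
pose f : {linear H -> H} := HB.pack W (GRing.isLinear.Build _ _ _ _ W Wlin).
rewrite -Wx ?mem_enum // -[W]/(f : H -> H) linear_sum.
by apply: eq_bigr => k _; rewrite linearZ.
Qed.

End Orthonormal.

Section DiagonalOperators.
Variables (R : realType) (H : hilbertType R) (N : nat) (g : 'I_N -> H).
Hypothesis gE : forall k l, inner (g k) (g l) = (k == l)%:R.
Local Notation "''[' u , v ]" := (inner u v).
Implicit Types (u w : 'I_N -> R[i]) (x y : H).

(** Multiplication by [u k] along [g k] and the identity on the orthogonal complement, written as a
    finite rank perturbation of the identity. *)
Definition diag_op u x := x + \sum_k ((u k - 1) * '[x, g k]) *: g k.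

Lemma inner_sum_orthonormal (c : 'I_N -> R[i]) k : '[\sum_l c l *: g l, g k] = c k.
Proof.
rewrite inner_suml (bigD1 k) //= big1 ?addr0 => [|l lk].
  by rewrite dotZl gE eqxx mulr1.
by rewrite dotZl gE (negPf lk) mulr0.
Qed.

Lemma inner_diag_op u x k : '[diag_op u x, g k] = u k * '[x, g k].
Proof. by rewrite dotDl inner_sum_orthonormal mulrBl mul1r addrC subrK. Qed.

Lemma diag_op_linear u : linear (diag_op u).
Proof.
move=> a x y; rewrite /diag_op scalerDr scaler_sumr addrACA -big_split /=.
congr (_ + _); apply: eq_bigr => k _.
by rewrite dotDl dotZl scalerA -scalerDl mulrDr mulrCA.
Qed.

Lemma diag_op1 x : diag_op (fun=> 1) x = x.
Proof. by rewrite /diag_op big1 ?addr0 // => k _; rewrite subrr mul0r scale0r. Qed.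

Lemma diag_op_comp u w x : diag_op u (diag_op w x) = diag_op (fun k => u k * w k) x.
Proof.
rewrite {1}/diag_op {1}/diag_op -addrA -big_split; congr (_ + _).
apply: eq_bigr => k _ /=; rewrite inner_diag_op -scalerDl; congr (_ *: _).
by ring.
Qed.

Lemma diag_op_adjoint u x y : '[diag_op u x, y] = '[x, diag_op (fun k => Num.conj (u k)) y].
Proof.
rewrite /diag_op dotDl dotDr inner_suml inner_sumr; congr (_ + _).
apply: eq_bigr => k _; rewrite dotZl dotZr rmorphM rmorphB rmorph1 /= conjCK.
by rewrite -dot_conj mulrAC.
Qed.

Lemma diag_op_sum u (c : 'I_N -> R[i]) :
  diag_op u (\sum_k c k *: g k) = \sum_k (u k * c k) *: g k.
Proof.
rewrite /diag_op -big_split /=; apply: eq_bigr => k _.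
by rewrite inner_sum_orthonormal -scalerDl; congr (_ *: _); ring.
Qed.

Lemma rnorm_diag_opB u x :
  rnorm (diag_op u x - x) ^+ 2 = \sum_k rnorm (u k - 1) ^+ 2 * rnorm '[x, g k] ^+ 2.
Proof.
rewrite /diag_op addrC addKr -Re_inner_rnorm inner_sumr raddf_sum.
apply: eq_bigr => k _; rewrite dotZr inner_sum_orthonormal -exprMn -rnormM.
by rewrite mulrC -sqr_normc rnormE -rmorphXn.
Qed.

Section UnitDiagonal.
Variable u : 'I_N -> R[i].
Hypothesis u1 : forall k, u k * Num.conj (u k) = 1.

Lemma diag_op_unitary : unitary (diag_op u).
Proof.
split; first exact: diag_op_linear.
exists (diag_op (fun k => Num.conj (u k))); split.
- by move=> x y; exact: diag_op_adjoint.
- move=> x; rewrite diag_op_comp -[RHS]diag_op1; congr (diag_op _ x).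
  by apply/funext => k; rewrite mulrC u1.
- move=> x; rewrite diag_op_comp -[RHS]diag_op1; congr (diag_op _ x).
  by apply/funext => k; rewrite u1.
Qed.

Lemma rnorm_diag_op x : rnorm (diag_op u x) = rnorm x.
Proof.
apply/eqP; rewrite -(@eqrXn2 _ 2) ?rnorm_ge0 // -!Re_inner_rnorm.
rewrite diag_op_adjoint diag_op_comp -[in X in _ == X](diag_op1 x).
apply/eqP; congr (complex.Re '[_, diag_op _ x]).
  by rewrite diag_op1.
by apply/funext => k; rewrite mulrC u1.
Qed.

End UnitDiagonal.

End DiagonalOperators.

(** * Positivity of the Toeplitz kernel of a contraction *)

Section ToeplitzPositivity.
Variables (R : realType) (H : hilbertType R) (C : {linear H -> H}).
Hypothesis C_contr : forall x, rnorm (C x) <= rnorm x.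
Local Notation "''[' u , v ]" := (inner u v).

(** For an isometry [C] this equals the inner product of [iter k C (u k)] and [iter l C (u l)], so
    its double sum is a squared norm; a contraction still gives a nonnegative sum. *)
Definition toeplitz (u : nat -> H) (k l : nat) : R[i] :=
  if (l <= k)%N then '[iter (k - l) C (u k), u l]
  else Num.conj '[iter (l - k) C (u l), u k].

(* With [v M u := \sum_k C^k (u k)], the kernel splits off [|u 0|^2 +
   2 Re <C v, u 0>] and [|C v| <= |v|]; this is why the bound is kept at
   [|v|^2] instead of [0]. *)
Lemma toeplitz_ge (M : nat) (u : nat -> H) :
  (rnorm (\sum_(k < M.+1) iter k C (u k)) ^+ 2)%:C
    <= \sum_(k < M.+1) \sum_(l < M.+1) toeplitz u k l.
Proof.
elim: M u => [|M IH] u.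
  by rewrite !big_ord1 /= /toeplitz /= inner_rnorm.
set v := \sum_(k < M.+1) iter k C (u k.+1).
have -> : \sum_(k < M.+2) iter k C (u k) = u 0%N + C v.
  by rewrite big_ord_recl linear_sum.
have row0 : \sum_(l < M.+1) toeplitz u 0 l.+1 = Num.conj '[C v, u 0%N].
  rewrite linear_sum inner_suml rmorph_sum; apply: eq_bigr => l _.
  by rewrite /toeplitz /= ?subn0.
have col0 : \sum_(k < M.+1) toeplitz u k.+1 0 = '[C v, u 0%N].
  rewrite linear_sum inner_suml; apply: eq_bigr => l _.
  by rewrite /toeplitz /= ?subn0.
have := IH (fun k => u k.+1); rewrite -/v => {}IH.
rewrite big_ord_recl [X in _ <= X + _]big_ord_recl /=.
have -> : \sum_(l < M.+1) toeplitz u 0 (bump 0 l) = _ := row0.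
have -> : \sum_(k < M.+1) \sum_(l < M.+2) toeplitz u (bump 0 k) l =
    '[C v, u 0%N] +
    \sum_(k < M.+1) \sum_(l < M.+1) toeplitz (fun k => u k.+1) k l.
  rewrite -col0 -big_split /=; apply: eq_bigr => k _.
  by rewrite big_ord_recl.
rewrite {1}/toeplitz /= inner_rnorm rnorm_sqrD.
rewrite addrA -(addrA (_)%:C) (addrC (Num.conj _)) conjCE addcJ.
apply: (@le_trans _ _ ((rnorm (u 0%N) ^+ 2)%:C +
    2%:R * (complex.Re '[C v, u 0%N])%:C + (rnorm v ^+ 2)%:C)); last first.
  by rewrite lerD2l.
rewrite -(rmorph_nat (real_complex R)) -!rmorphM -!rmorphD lecR /= Re_innerC.
have : rnorm (C v) ^+ 2 <= rnorm v ^+ 2 by rewrite ler_sqr ?nnegrE ?rnorm_ge0.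
by lra.
Qed.

(** Summing over [I] first collapses the block kernel to the scalar case, with [u k] the combination
    of the [x i] with coefficients [c (i, k)]. The form of [G] matches the hypothesis of
    [toeplitz_moments]. *)
Lemma toeplitz_kernel_ge0 (I : finType) (M : nat) (x : I -> H)
    (tau := fun m i j => '[iter m C (x i), x j])
    (G := fun p q : I * 'I_M.+1 =>
       if (q.2 <= p.2)%N then tau (p.2 - q.2)%N p.1 q.1
       else Num.conj (tau (q.2 - p.2)%N q.1 p.1)) (c : I * 'I_M.+1 -> R[i]) :
  0 <= \sum_p \sum_q c p * Num.conj (c q) * G p q.
Proof.
pose u (k : nat) := \sum_i c (i, inord k) *: x i.
have -> : \sum_p \sum_q c p * Num.conj (c q) * G p q =
    \sum_(k < M.+1) \sum_(l < M.+1) toeplitz u k l.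
  transitivity (\sum_i \sum_(k < M.+1) \sum_j \sum_(l < M.+1)
      c (i, k) * Num.conj (c (j, l)) * G (i, k) (j, l)).
    rewrite [RHS]pair_big /=; apply: eq_bigr => -[i k] _ /=.
    by rewrite [RHS]pair_big /=; apply: eq_bigr => -[j l] _.
  rewrite exchange_big; apply: eq_bigr => k _ /=.
  under eq_bigr do rewrite exchange_big.
  rewrite exchange_big; apply: eq_bigr => l _ /=.
  have iter_u m (n : 'I_M.+1) : iter m C (u n) = \sum_i c (i, n) *: iter m C (x i).
    elim: m => [|m IH] /=; first by rewrite /u inord_val.
    by rewrite IH linear_sum; apply: eq_bigr => i _; rewrite linearZ.
  rewrite /toeplitz !iter_u /G /tau /= {1}/u {1}/u !inord_val.
  case: ifP => _; rewrite inner_suml.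
    apply: eq_bigr => i _; rewrite inner_sumr; apply: eq_bigr => j _.
    by rewrite dotZl dotZr mulrA.
  rewrite rmorph_sum exchange_big /=; apply: eq_bigr => j _.
  rewrite inner_sumr rmorph_sum; apply: eq_bigr => i _ /=.
  by rewrite dotZl dotZr !rmorphM /= conjCK mulrCA mulrA.
by apply: le_trans (toeplitz_ge M u); rewrite ler0c exprn_ge0 ?rnorm_ge0.
Qed.

End ToeplitzPositivity.

(** * Interpolation of a contractive semigroup by a diagonal unitary group *)

Section UnitaryApproximation.
Variables (R : realType) (H : hilbertType R).
Hypothesis Hinf : ~ finite_dimensional H.
Local Notation "''[' u , v ]" := (inner u v).

Section DiagonalGroup.
Variables (N : nat) (g : 'I_N -> H) (theta : 'I_N -> R).
Hypothesis gE : forall k l, '[g k, g l] = (k == l)%:R.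

Definition diag_group (t : Rplus R) : H -> H :=
  diag_op g (fun k => expi (theta k * set_val t)).

Lemma diag_group_unitary t : unitary (diag_group t).
Proof. by apply: diag_op_unitary => // k; rewrite expi_mul_conj. Qed.

Lemma diag_group_C0 : contractive_C0 diag_group.
Proof.
apply: contractive_C0_intro.
- by move=> t _; exact: diag_op_linear.
- by move=> t x _; rewrite rnorm_diag_op // => k; rewrite expi_mul_conj.
- move=> x; rewrite /diag_group set_val_rp // -[RHS](diag_op1 g).
  by congr (diag_op _ _ x); apply/funext => k; rewrite mulr0 expi0.
- move=> s t x s0 t0; rewrite /diag_group diag_op_comp //.
  rewrite !set_val_rp ?addr_ge0 //; congr (diag_op _ _ x).
  by apply/funext => k; rewrite mulrDr expiD.
move=> x e e0.
(* This is the squared displacement of [x] at time [t], a finite sum and hence continuous. *)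
pose f (t : R) := \sum_k (2 - 2 * cos (theta k * t)) * rnorm '[x, g k] ^+ 2.
have fc : f @ (0 : R) --> f 0.
  apply: cvg_big => [|k _]; first exact: add_continuous.
  apply: cvgMl; apply: cvgB; first exact: cvg_cst.
  apply: cvgMr; apply: (@cvg_comp _ _ _ (fun t => theta k * t) cos _ (nbhs (theta k * 0))).
    by apply: cvgMr; exact: cvg_id.
  exact: continuous_cos.
have f0 : f 0 = 0.
  by rewrite /f big1 // => k _; rewrite mulr0 cos0 mulr1 subrr mul0r.
move/cvgrPdist_lt : fc => /(_ (e ^+ 2)); rewrite f0 exprn_gt0 // => /(_ isT).
move/nbhs_norm0P => [h /= h0 hf].
exists (h / 2); first by rewrite divr_gt0.
move=> t t0 th; rewrite -(@ltr_pXn2r _ 2) ?nnegrE ?rnorm_ge0 ?ltW //.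
have -> : rnorm (diag_group (rp t) x - x) ^+ 2 = f t.
  rewrite rnorm_diag_opB //; apply: eq_bigr => k _.
  by rewrite rnorm_expiB1 set_val_rp.
have : `|0 - f t| < e ^+ 2.
  apply: hf; rewrite /= ger0_norm // (le_lt_trans th) //.
  by rewrite ltr_pdivrMr // ltr_pMr // ltr1n.
by rewrite sub0r normrN; exact/le_lt_trans/ler_norm.
Qed.

End DiagonalGroup.

Lemma unitary_approximation (T : Rplus R -> H -> H) (I : finType) (x : I -> H)
    (a e : R) :
  contractive_C0 T -> 0 <= a -> 0 < e ->
  exists V : Rplus R -> H -> H,
    [/\ contractive_C0 V, forall t, unitary (V t) &
      forall t, set_val t <= a -> forall i j,
        rnorm '[V t (x i) - T t (x i), x j] < e].
Proof.
move=> TC0 a0 e0.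
pose B : R := 1 + \sum_i rnorm (x i).
have B0 : 0 < B by rewrite ltr_pwDl // sumr_ge0 // => i _; exact: rnorm_ge0.
have xB i : rnorm (x i) <= B.
  rewrite /B (bigD1 i) //= addrCA lerDl addr_ge0 // sumr_ge0 // => j _.
  exact: rnorm_ge0.
(* The first bound gives the motion of [T] within one step a share [e / 2] of the error. The second
   makes [2 * (d * B)] at most the square of [e / (2 * B)], which does the same for [V]. *)
pose d := Num.min (e / (2 * B)) (e ^+ 2 / (8 * B ^+ 3)).
have d0 : 0 < d by rewrite lt_min !divr_gt0 ?mulr_gt0 ?exprn_gt0.
have [h h0 hT] : exists2 h, 0 < h & forall i t, 0 <= t -> t <= h ->
    rnorm (T (rp t) (x i) - x i) < d.
  have hh i := C0_continuous0 TC0 (x i) d0.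
  have [s sP] := choice (fun i => let: ex_intro2 h h0 hT := hh i in
    ex_intro _ h (conj h0 hT)).
  exists (\big[Num.min/1]_i s i).
    by elim/big_ind : _ => // [y z y0 z0|i _]; rewrite ?lt_min ?y0 //; have [] := sP i.
  move=> i t t0 th; have [_ siT] := sP i; apply: siT => //.
  by apply: le_trans th _; rewrite (bigD1 i) //= ge_min lexx.
(* The successor ensures [1 <= M], so that time [h] is a grid point even when [a < h]. *)
pose M := (Num.truncn (a / h)).+1.
have C_lin : linear (T (rp h)) := C0_linear TC0 h.
pose C : {linear H -> H} := HB.pack (T (rp h)) (GRing.isLinear.Build _ _ _ _ _ C_lin).
have C_contr y : rnorm (C y) <= rnorm y := C0_rnorm TC0 h y.
have iterC m y : iter m C y = T (rp (m%:R * h)) y.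
  elim: m => [|m IH]; first by rewrite mul0r C0_0.
  by rewrite iterS IH mulrS mulrDl mul1r C0D // ?mulr_ge0 // ltW.
pose tau m i j := '[iter m C (x i), x j].
have [||N [mu [c [mu1 cE]]]] := @toeplitz_moments _ I M tau.
- by move=> i j; rewrite /tau /= dot_conj.
- by move=> c; exact: (toeplitz_kernel_ge0 C_contr).
have [|g [gE xg]] := @orthonormal_coordinates _ _ I N x c Hinf.
  move=> i j; rewrite -[RHS](cE 0%N i j) //.
  by apply: eq_bigr => k _; rewrite expr0 mul1r.
have [theta theta_pi] := choice (fun k =>
  let: ex_intro2 a p q := unit_complex_expi (mu1 k) in ex_intro _ a (conj p q)).
(* At time [m%:R * h] this group multiplies the [k]-th coordinate by [mu k ^+ m], so its matrix
   coefficients there are the moments [tau m]. *)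
pose V := diag_group g (fun k => theta k / h).
have VC0 : contractive_C0 V by exact: diag_group_C0.
have VE m i j : (m <= M)%N ->
    '[V (rp (m%:R * h)) (x i), x j] = '[T (rp (m%:R * h)) (x i), x j].
  move=> mM; rewrite -iterC -[RHS](cE m) // (xg i) (xg j) /V /diag_group.
  rewrite diag_op_sum // inner_suml; apply: eq_bigr => k _.
  rewrite inner_sumr (bigD1 k) //= big1 => [|l lk].
    rewrite dotZl dotZr gE eqxx mulr1 addr0 mulrA; congr (_ * _ * _).
    rewrite set_val_rp ?mulr_ge0 // ?ltW // mulrA mulrAC divfK ?gt_eqF //.
    by rewrite mulr_natr expiMn; have [_ ->] := theta_pi k.
  by rewrite dotZl dotZr gE eq_sym (negPf lk) !mulr0.
have Vh i : rnorm (V (rp h) (x i) - x i) < e / (2 * B).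
  rewrite -(@ltr_pXn2r _ 2) ?nnegrE ?rnorm_ge0 ?divr_ge0 ?mulr_ge0 ?(ltW e0) ?(ltW B0) //.
  (* [V] preserves norms and has the same diagonal coefficient as [T] at time [h], so weak
     information on [T] controls the strong displacement of [V]. *)
  have -> : rnorm (V (rp h) (x i) - x i) ^+ 2 =
      2 * complex.Re '[x i - T (rp h) (x i), x i].
    have := VE 1%N i i isT; rewrite mul1r => VT.
    rewrite rnorm_sqrB VT /V /diag_group rnorm_diag_op // => [|k]; last first.
      by rewrite expi_mul_conj.
    by rewrite dotBl raddfB /= Re_inner_rnorm; ring.
  have le1 : complex.Re '[x i - T (rp h) (x i), x i] < d * B.
    apply: le_lt_trans (Re_le_rnorm _) _; apply: le_lt_trans (cauchy_schwarz _ _) _.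
    rewrite rnormB; apply: (@le_lt_trans _ _ (rnorm (T (rp h) (x i) - x i) * B)).
      by rewrite ler_wpM2l ?rnorm_ge0.
    by rewrite ltr_pM2r // hT // ltW.
  apply: lt_le_trans (_ : 2 * (d * B) <= _); first by rewrite ltr_pM2l.
  apply: (@le_trans _ _ (2 * (e ^+ 2 / (8 * B ^+ 3) * B))).
    by rewrite ler_pM2l // ler_pM2r // /d ge_min lexx orbT.
  by rewrite le_eqVlt; apply/orP; left; apply/eqP; field; rewrite gt_eqF.
have Vs i s : 0 <= s -> s <= h ->
    rnorm (V (rp s) (x i) - x i) <= rnorm (V (rp h) (x i) - x i).
  move=> s0 sh; rewrite -(@ler_pXn2r _ 2) ?nnegrE ?rnorm_ge0 //.
  rewrite !rnorm_diag_opB // ler_sum // => k _.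
  rewrite ler_wpM2r ?exprn_ge0 ?rnorm_ge0 // !set_val_rp ?(ltW h0) //.
  rewrite divfK ?gt_eqF // mulrAC -mulrA rnorm_expiB1_le //.
    by have [] := theta_pi k.
  by rewrite divr_ge0 ?(ltW h0) //= ler_pdivrMr // mul1r.
exists V; split=> //; first by move=> t; exact: diag_group_unitary.
move=> t ta i j; have t0 := set_val_ge0 t.
have /truncn_itv/andP[] : 0 <= set_val t / h by rewrite divr_ge0 // ltW.
set m := Num.truncn (set_val t / h).
rewrite ler_pdivlMr // ltr_pdivrMr // => mt tm.
have mM : (m <= M)%N by rewrite leqW // le_truncn // ler_pM2r ?invr_gt0.
have mh0 : 0 <= m%:R * h by rewrite mulr_ge0 // ltW.
set s := set_val t - m%:R * h.
have s0 : 0 <= s by rewrite subr_ge0.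
have sh : s <= h by rewrite lerBlDr addrC -[X in _ + X]mul1r -mulrDl -natr1 in tm *; exact: ltW.
have dB : d <= e / (2 * B) by rewrite /d ge_min lexx.
(* The coefficients agree at the last grid point before [t], so only the two motions since then
   remain. *)
have -> : '[V t (x i) - T t (x i), x j] =
    '[V (rp (set_val t)) (x i) - V (rp (m%:R * h)) (x i), x j] +
    '[T (rp (m%:R * h)) (x i) - T (rp (set_val t)) (x i), x j].
  by rewrite rpK !dotBl VE // addrA subrK.
apply: le_lt_trans (rnormD _ _) _.
apply: (@le_lt_trans _ _ (rnorm (V (rp s) (x i) - x i) * B +
                          rnorm (T (rp s) (x i) - x i) * B)).
  apply: lerD; apply: le_trans (cauchy_schwarz _ _) _;
    apply: ler_pM; rewrite ?rnorm_ge0 //; first exact: C0_dist.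
  by rewrite rnormB; exact: C0_dist.
apply: (@lt_le_trans _ _ (e / (2 * B) * B + e / (2 * B) * B)); last first.
  by rewrite le_eqVlt; apply/orP; left; apply/eqP; field; rewrite gt_eqF.
apply: ltrD; rewrite ltr_pM2r //; first exact: le_lt_trans (Vs _ _ s0 sh) (Vh i).
exact: lt_le_trans (hT _ _ s0 sh) dB.
Qed.

End UnitaryApproximation.

(** * The space of contractive semigroups *)

Section SemigroupSpace.
Variables (R : realType) (H : hilbertType R).
Local Notation "''[' u , v ]" := (inner u v).
Local Notation X := (contractive_semigroup H).
Implicit Types (S T : X) (x y : H).

Lemma semigroup_C0 T : contractive_C0 (set_val T).
Proof. exact: (set_valP T). Qed.

Lemma cvg_semigroupP (F : set_system X) T : Filter F ->
  F --> T <->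
  forall x y (a e : R), 0 < e -> \forall S \near F, forall t, set_val t <= a ->
    rnorm '[set_val S t x - set_val T t x, y] < e.
Proof.
move=> FF; rewrite cvg_contractive_semigroupP; split=> [FT x y a e e0|FT x y K cK e e0].
  have := FT x y _ (@compact_Rplus_segment R a) e e0.
  by apply: filterS => S ST t ta; have := ST t ta; rewrite rnormE ltcR.
have [a _ Ka] := compact_Rplus_bounded cK.
have := FT x y a e e0; apply: filterS => S ST t Kt.
by rewrite rnormE ltcR; exact/ST/Ka.
Qed.

Definition basic_nbhs T (s : seq (H * H)) (a e : R) : set X :=
  [set S : X | forall p, p \in s -> forall t, set_val t <= a ->
     rnorm '[set_val S t p.1 - set_val T t p.1, p.2] < e].

Lemma nbhs_basic T s a (e : R) : 0 < e -> nbhs T (basic_nbhs T s a e).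
Proof.
move=> e0; have TT : nbhs T --> T by exact: cvg_id.
elim: s => [|p s IH]; first by apply: filterS filterT => S _ p.
have := (cvg_semigroupP T (nbhs_filter T)).1 TT p.1 p.2 a e e0.
apply: filterS2 IH => S Ss Sp q; rewrite inE => /orP[/eqP-> //|]; exact: Ss.
Qed.

(** The sets containing some [basic_nbhs] around [T] form a filter; it converges to [T] by
    [cvg_semigroupP], hence contains every neighbourhood. *)
Lemma nbhs_basicP T (A : set X) : nbhs T A ->
  exists s a e, [/\ 0 <= a, 0 < e & basic_nbhs T s a e `<=` A].
Proof.
pose F : set_system X := [set B | exists s a e,
  [/\ 0 <= a :> R, 0 < e :> R & basic_nbhs T s a e `<=` B]].
have FF : Filter F.
  split; first by exists [::], 0, 1.
    move=> B C [s [a [e [a0 e0 sB]]]] [s' [a' [e' [a'0 e'0 sC]]]].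
    exists (s ++ s'), (Num.max a a'), (Num.min e e').
    split; [by rewrite le_max a0 | by rewrite lt_min e0 | move=> S ST; split].
      apply: sB => p ps t ta; have := ST p; rewrite mem_cat ps => /(_ isT t).
      by rewrite le_max ta lt_min => /(_ isT)/andP[].
    apply: sC => p ps t ta; have := ST p; rewrite mem_cat ps orbT => /(_ isT t).
    by rewrite le_max ta orbT lt_min => /(_ isT)/andP[].
  by move=> B C BC [s [a [e [a0 e0 sB]]]]; exists s, a, e; split=> // S /sB /BC.
have FT : F --> T.
  apply/cvg_semigroupP => x y a e e0; exists [:: (x, y)], (Num.max 0 a), e.
  split=> [|//|S ST t ta]; first by rewrite le_max lexx.
  by apply: (ST (x, y) (mem_head _ _)); rewrite le_max ta orbT.
by move/FT.
Qed.

Lemma unitary_semigroups_dense : ~ finite_dimensional H ->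
  dense (@unitary_semigroups R H).
Proof.
move=> Hinf O [T OT] oO.
have [s [a [e [a0 e0 sO]]]] := nbhs_basicP (open_nbhs_nbhs (conj oO OT)).
(* Both entries of each pair go into one family, because [unitary_approximation] tests a family
   against itself. *)
pose x (i : 'I_(size s) * bool) :=
  let p := nth (0, 0) s i.1 in if i.2 then p.1 else p.2.
have [V [VC0 Vu VT]] := unitary_approximation Hinf x (semigroup_C0 T) a0 e0.
exists (exist _ V (mem_set VC0) : X); split => //.
apply: sO => p ps t ta; have pi : (index p s < size s)%N by rewrite index_mem.
by have := VT t ta (Ordinal pi, true) (Ordinal pi, false); rewrite /x /= nth_index.
Qed.

(** The ambient function space is uniform, hence regular, and regularity passes to subspaces. It
    supplies the closed neighbourhoods of the Baire argument. *)
Lemma semigroup_regular : regular_space X.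
Proof.
move=> T A [B [[B' oB' <-] /= B'T BA]].
have [V VT VB'] := @uniform_regular {family compact, Rplus R -> wot H} (set_val T) B'
  (open_nbhs_nbhs (conj oB' B'T)).
have set_val_cont := @initial_continuous _ {family compact, Rplus R -> wot H}
  (set_val : X -> _).
exists (set_val @^-1` V); first exact: set_val_cont.
move=> S clS; apply: BA => /=; apply: VB' => W SW.
by have [S' [VS' WS']] := clS _ (set_val_cont S W SW); exists (set_val S').
Qed.

Definition isometric T := forall t x, rnorm (set_val T t x) = rnorm x.

(* On the isometric elements the weak and the strong uniform convergence on
   compacts agree: [|S x - T x|^2 <= 2 Re <T x - S x, T x>], and the orbit
   [t |-> T t x] is covered by finitely many small balls. *)
Lemma strong_nbhs T x (a e : R) : isometric T -> 0 <= a -> 0 < e ->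
  nbhs T [set S : X | forall t, set_val t <= a ->
     rnorm (set_val S t x - set_val T t x) < e].
Proof.
move=> Tiso a0 e0; set B := rnorm x + 1.
have B0 : 0 < B by rewrite ltr_wpDl // rnorm_ge0.
have d0 : 0 < e ^+ 2 / (8 * B) by rewrite divr_gt0 ?exprn_gt0 ?mulr_gt0.
have [h h0 hT] := C0_continuous0 (semigroup_C0 T) x d0.
pose M := Num.truncn (a / h).
(* The orbit is sampled at grid times. The mesh error, paired with a vector of norm at most [2 * B],
   costs [e ^+ 2 / 4], as does the weak error; doubling their sum gives [e ^+ 2]. *)
pose s := [seq (x, set_val T (rp (m%:R * h)) x) | m <- iota 0 M.+1].
have d1 : 0 < e ^+ 2 / 4 by rewrite divr_gt0 ?exprn_gt0.
have := nbhs_basic T s a d1; apply: filterS => S ST t ta.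
have t0 := set_val_ge0 t.
have /truncn_itv/andP[] : 0 <= set_val t / h by rewrite divr_ge0 // ltW.
set m := Num.truncn (set_val t / h).
rewrite ler_pdivlMr // ltr_pdivrMr // => mt tm.
have mM : (m <= M)%N by rewrite le_truncn // ler_pM2r ?invr_gt0.
have mh0 : 0 <= m%:R * h by rewrite mulr_ge0 // ltW.
set T' := set_val T (rp (m%:R * h)) x.
have ST' : rnorm '[set_val S t x - set_val T t x, T'] < e ^+ 2 / 4.
  apply: (ST (x, T')) => //; apply/mapP; exists m => //.
  by rewrite mem_iota ltnS.
have TT' : rnorm (set_val T t x - T') < e ^+ 2 / (8 * B).
  rewrite -(rpK t); apply: le_lt_trans (C0_dist (semigroup_C0 T) _ mh0 mt) _.
  apply: hT; first by rewrite subr_ge0.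
  by move: tm; rewrite -natr1 mulrDl mul1r lerBlDl => /ltW.
have Sx : rnorm (set_val S t x) <= rnorm x.
  by rewrite -(rpK t); exact: C0_rnorm (semigroup_C0 S) _ _.
rewrite -(@ltr_pXn2r _ 2) ?nnegrE ?rnorm_ge0 ?(ltW e0) // rnorm_sqrB.
have -> : complex.Re '[set_val S t x, set_val T t x] =
    rnorm (set_val T t x) ^+ 2 + complex.Re '[set_val S t x - set_val T t x, T']
    + complex.Re '[set_val S t x - set_val T t x, set_val T t x - T'].
  have -> : complex.Re '[set_val S t x - set_val T t x, set_val T t x - T'] =
      complex.Re '[set_val S t x, set_val T t x] - rnorm (set_val T t x) ^+ 2
      - complex.Re '[set_val S t x - set_val T t x, T'].
    by rewrite dotBr raddfB /= dotBl raddfB /= Re_inner_rnorm.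
  by ring.
have b1 : - complex.Re '[set_val S t x - set_val T t x, T'] < e ^+ 2 / 4.
  by rewrite -raddfN /=; apply: le_lt_trans (Re_le_rnorm _) _; rewrite rnormN.
have b2 : - complex.Re '[set_val S t x - set_val T t x, set_val T t x - T'] <
          2 * B * (e ^+ 2 / (8 * B)).
  rewrite -raddfN /=; apply: le_lt_trans (Re_le_rnorm _) _; rewrite rnormN.
  apply: le_lt_trans (cauchy_schwarz _ _) _.
  apply: (@le_lt_trans _ _ (2 * B * rnorm (set_val T t x - T'))); last first.
    by rewrite ltr_pM2l ?mulr_gt0.
  rewrite ler_wpM2r ?rnorm_ge0 //; apply: le_trans (rnormD _ _) _.
  by rewrite rnormN Tiso /B; have := rnorm_ge0 x; lra.
have b3 : 2 * B * (e ^+ 2 / (8 * B)) = e ^+ 2 / 4 by field; rewrite gt_eqF.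
have b4 : rnorm (set_val S t x) ^+ 2 <= rnorm x ^+ 2.
  by rewrite ler_sqr ?nnegrE ?rnorm_ge0.
rewrite Tiso; move: b1 b2 b4; rewrite b3; lra.
Qed.

End SemigroupSpace.

(** * Surjective isometries are unitary *)

Section IsometrySurjection.
Variables (R : realType) (H : hilbertType R) (f : H -> H).
Hypotheses (f_lin : linear f) (f_iso : forall x, rnorm (f x) = rnorm x).
Local Notation "''[' u , v ]" := (inner u v).

Lemma linear_fB x y : f (x - y) = f x - f y.
Proof. by rewrite addrC -scaleN1r f_lin scaleN1r addrC. Qed.

(** Norms determine real parts of inner products by polarization; the imaginary part is the real
    part after multiplying the second argument by the imaginary unit. *)
Lemma isometry_inner x y : '[f x, f y] = '[x, y].
Proof.
have fRe u v : complex.Re '[f u, f v] = complex.Re '[u, v].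
  have := rnorm_sqrB (f u) (f v); rewrite -linear_fB !f_iso rnorm_sqrB; lra.
have f0 : f 0 = 0 by have := linear_fB 0 0; rewrite !subrr.
have fZ a u : f (a *: u) = a *: f u by have := f_lin a u 0; rewrite f0 !addr0.
have ImE u v : complex.Im '[u, v] = complex.Re '[u, (0 +i* 1) *: v].
  by rewrite dotZr conjCE /=; case: '[u, v] => p q /=; rewrite !mul0r; ring.
have := fRe x y; have := fRe x ((0 +i* 1) *: y); rewrite fZ -!ImE => hI hR.
by apply/eqP; rewrite eq_complex hI hR !eqxx.
Qed.

Lemma isometry_surjective_unitary : (forall y, exists x, f x = y) -> unitary f.
Proof.
move=> /choice[g fg]; split=> //; exists g; split=> //.
  by move=> x y; rewrite -[in LHS](fg y) isometry_inner.
move=> x; apply/eqP; rewrite -subr_eq0 -rnorm_eq0 -f_iso linear_fB fg subrr.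
by rewrite rnorm0.
Qed.

(** Preimages of approximations to [y] form a Cauchy sequence because [f] preserves distances; their
    limit is a preimage of [y]. *)
Lemma isometry_dense_range_surjective :
  (forall y (e : R), 0 < e -> exists x, rnorm (f x - y) < e) ->
  forall y, exists x, f x = y.
Proof.
move=> fdense y; have inv_gt0 (n : nat) : 0 < n.+1%:R^-1 :> R by rewrite invr_gt0.
have [x xP] := choice (fun n : nat => fdense y _ (inv_gt0 n)).
have fx_cvg (e : R) : 0 < e ->
    exists N, forall n, (N <= n)%N -> rnorm (f (x n) - y) < e.
  move=> e0; have [N _ Ne] := near_infty_natSinv_lt (PosNum e0).
  exists N => n Nn; apply: lt_trans (xP n) _; exact: Ne.
have : cvg (x @ \oo).
  apply: cauchy_rnorm_cvg => e e0; have [|N xN] := fx_cvg (e / 2).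
    by rewrite divr_gt0.
  exists N => n Nn; rewrite -f_iso linear_fB.
  apply: le_lt_trans (rnorm_dist y _ _) _.
  by rewrite (rnormB y) [ltRHS]splitr ltrD ?xN.
move=> /cvg_ex[z xz]; exists z; apply/eqP; rewrite -subr_eq0 -rnorm_eq0 eq_le rnorm_ge0 andbT.
apply/ler_addgt0Pl => e e0; rewrite addr0.
have [|N xN] := fx_cvg (e / 2); first by rewrite divr_gt0.
have /cvg_rnormP/(_ (e / 2))/(_ _)[|M _ xM] := xz; first by rewrite divr_gt0.
apply: le_trans (rnorm_dist (f (x (maxn N M))) _ _) _.
rewrite -linear_fB f_iso (rnormB z) [leRHS]splitr; apply: lerD; apply: ltW.
  by apply: xM; rewrite /= leq_maxr.
by rewrite xN ?leq_maxl.
Qed.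

End IsometrySurjection.

Lemma unitary_rnorm (R : realType) (H : hilbertType R) (f : H -> H) x :
  unitary f -> rnorm (f x) = rnorm x.
Proof.
move=> [_ [g [fg fK _]]]; apply/eqP; rewrite -(@eqrXn2 _ 2) ?rnorm_ge0 //.
by rewrite -!Re_inner_rnorm fg fK.
Qed.

Lemma separable_seq (R : realType) (H : hilbertType R) : separable H ->
  exists d : nat -> H, forall x (e : R), 0 < e -> exists n, rnorm (x - d n) < e.
Proof.
move=> [D cD dD]; have [D0|] := pfcard_geP cD.
  have [||y []] := dD setT; [by exists 0 | exact: openT | by rewrite D0].
move=> [d]; exists d => x e e0.
have ec0 : 0 < e%:C by rewrite ltcR.
have [||y [xy Dy]] := dD (ball x e%:C).
- by exists x; exact: ballxx.
- exact: ball_open.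
have [n _ dn] := 'surj_d Dy; exists n.
by move: xy; rewrite dn -ball_normE /= rnormE ltcR.
Qed.

(** * Unitary semigroups as a countable intersection of open sets *)

Section Residual.
Variables (R : realType) (H : hilbertType R) (d : nat -> H).
Hypothesis d_dense : forall x (e : R), 0 < e -> exists n, rnorm (x - d n) < e.
Local Notation "''[' u , v ]" := (inner u v).
Local Notation X := (contractive_semigroup H).
Implicit Types (S T : X) (x y : H).

(* Both suprema [sup_y (2 Re <f x, y> - |y|^2) = |f x|^2] and
   [sup_y (2 Re <f y, x> - |y|^2) = |f^* x|^2] are weakly lower semicontinuous
   in [f]; here [f] is the operator at time [1]. *)
Definition almost_unitary_at (m n : nat) : set X :=
  [set T : X |
     (exists y, rnorm (d n) ^+ 2 - m.+1%:R^-1 <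
        2 * complex.Re '[set_val T (rp 1) (d n), y] - rnorm y ^+ 2) /\
     (exists y, rnorm (d n) ^+ 2 - m.+1%:R^-1 <
        2 * complex.Re '[set_val T (rp 1) y, d n] - rnorm y ^+ 2)].

(** One index bounds both the tolerance and the number of tested vectors: each condition is finite,
    hence open, yet every [d n] is tested with arbitrarily small tolerance. *)
Definition almost_unitary (m : nat) : set X :=
  [set T : X | forall n : 'I_m.+1, almost_unitary_at m n T].

Lemma open_almost_unitary m : open (almost_unitary m).
Proof.
have weak (x y : H) (T : X) (c r : R) :
    c < 2 * complex.Re '[set_val T (rp 1) x, y] - r ->
    \forall S \near T, c < 2 * complex.Re '[set_val S (rp 1) x, y] - r.
  set b := complex.Re _ => cb; have e0 : 0 < (2 * b - r - c) / 2.
    by rewrite divr_gt0 // subr_gt0.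
  have := nbhs_basic T [:: (x, y)] 1 e0; apply: filterS => S.
  move=> /(_ (x, y) (mem_head _ _) (rp 1)); rewrite set_val_rp // => /(_ (lexx _)) /=.
  rewrite -rnormN => /(le_lt_trans (Re_le_rnorm _)).
  by rewrite dotBl raddfN raddfB /= -/b; lra.
rewrite openE => T TO; apply: (@filter_forall X 'I_m.+1 (almost_unitary_at m) (nbhs T)) => n.
have [[y yT] [z zT]] := TO n.
have := weak _ _ _ _ _ zT; have := weak _ _ _ _ _ yT.
by apply: filterS2 => S Sy Sz; split; [exists y | exists z].
Qed.

(** Both suprema are attained, at the image of [d n] under the operator at time 1 and at its
    preimage. *)
Lemma unitary_almost_unitary T m : unitary_semigroups T -> almost_unitary m T.
Proof.
move=> Tu n; have := Tu (rp 1) => fu; have m0 : 0 < m.+1%:R^-1 :> R by rewrite invr_gt0.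
have [_ [g [fg fK gK]]] := fu; split.
  exists (set_val T (rp 1) (d n)); rewrite Re_inner_rnorm unitary_rnorm //.
  by rewrite mulr_natl mulr2n addrK ltrBlDr ltrDl.
exists (g (d n)); rewrite fg Re_inner_rnorm -[in rnorm (d n)](gK (d n)) unitary_rnorm //.
by rewrite mulr_natl mulr2n addrK ltrBlDr ltrDl.
Qed.

Lemma almost_unitary_unitary T : (forall m, almost_unitary m T) -> unitary_semigroups T.
Proof.
move=> TO; have TC0 := semigroup_C0 T; set f := set_val T in TC0 *.
have small (r : R) n : 0 < r -> exists m, (n <= m)%N /\ m.+1%:R^-1 < r.
  move=> r0; have [N _ Nr] := near_infty_natSinv_lt (PosNum r0).
  by exists (maxn n N); rewrite leq_maxl; split=> //; apply: Nr; rewrite /= leq_maxr.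
(* Nonnegativity of the squared distance from the image of [d n] to the witness [y] bounds the
   tested quantity by the squared norm of that image. *)
have d_iso n : rnorm (f (rp 1) (d n)) = rnorm (d n).
  apply/eqP; rewrite eq_le C0_rnorm // -(@ler_pXn2r _ 2) ?nnegrE ?rnorm_ge0 //.
  apply/ler_addgt0Pl => e /(small _ n)[m [nm me]].
  have [[y yT] _] := TO m (Ordinal (nm : (n < m.+1)%N)).
  have := exprn_ge0 2 (rnorm_ge0 (f (rp 1) (d n) - y)); rewrite rnorm_sqrB.
  by move: yT me; rewrite /= -/f; move: (m.+1%:R^-1) => r; lra.
have iso1 x : rnorm (f (rp 1) x) = rnorm x.
  apply/eqP; rewrite eq_le C0_rnorm //=; apply/ler_addgt0Pl => e e0.
  have [|n xn] := d_dense x (e := e / 2); first by rewrite divr_gt0.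
  have := rnorm_dist (d n) x 0; have := rnorm_dist (f (rp 1) x) (f (rp 1) (d n)) 0.
  rewrite !subr0 -C0B // d_iso.
  have := C0_rnorm TC0 1 (d n - x); rewrite (rnormB (d n)); move: xn; lra.
(* With [iso1], the second condition says that the image of the witness [z] is close to [d n], so
   the range is dense. *)
have surj1 : forall y, exists x, f (rp 1) x = y.
  apply: isometry_dense_range_surjective => //; first exact: C0_linear.
  move=> y e e0; have [|n yn] := d_dense y (e := e / 2); first by rewrite divr_gt0.
  have [|m [nm me]] := small ((e / 2) ^+ 2) n; first by rewrite exprn_gt0 ?divr_gt0.
  have [_ [z zT]] := TO m (Ordinal (nm : (n < m.+1)%N)); exists z.
  apply: le_lt_trans (rnorm_dist (d n) _ _) _; rewrite [ltRHS]splitr (rnormB (d n)).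
  rewrite ltrD // -(@ltr_pXn2r _ 2) ?nnegrE ?rnorm_ge0 ?divr_ge0 ?(ltW e0) //.
  by rewrite rnorm_sqrB iso1; move: zT me; rewrite /= -/f; move: (m.+1%:R^-1) => r; lra.
have fN n x : f (rp n%:R) x = iter n (f (rp 1)) x.
  elim: n => [|n IH]; first by rewrite C0_0.
  by rewrite -natr1 addrC C0D // IH.
have isoN n x : rnorm (f (rp n%:R) x) = rnorm x.
  by rewrite fN; elim: n => //= n IH; rewrite iso1.
have surjN n y : exists x, f (rp n%:R) x = y.
  suff [x <-] : exists x, iter n (f (rp 1)) x = y by exists x; rewrite fN.
  elim: n y => [|n IH] y; first by exists y.
  by have [z <-] := surj1 y; have [x <-] := IH z; exists x.
move=> t; rewrite -(rpK t); have t0 := set_val_ge0 t.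
(* For an integer [n] above [s], the operator at time [n] factors through those at [s] and [n - s]
   in either order. Its isometry and its surjectivity therefore both pass to time [s]. *)
set s := set_val t in t0 *; pose n := (Num.truncn s).+1.
have sn : 0 <= n%:R - s.
  by rewrite subr_ge0 ltW //; have /andP[] := truncn_itv t0.
apply: isometry_surjective_unitary.
- exact: C0_linear.
- move=> x; apply/eqP; rewrite eq_le C0_rnorm //= -(isoN n) -(subrK s n%:R).
  by rewrite C0D // C0_rnorm.
- move=> y; have [x <-] := surjN n y; exists (f (rp (n%:R - s)) x).
  by rewrite -C0D // addrC subrK.
Qed.

Lemma bigcap_almost_unitary : \bigcap_m almost_unitary m = @unitary_semigroups R H.
Proof.
apply/seteqP; split=> T TU; last by move=> m _; exact: unitary_almost_unitary.
by apply: almost_unitary_unitary => m; exact: TU.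
Qed.

Lemma unitary_semigroups_residual :
  ~ finite_dimensional H -> residual (@unitary_semigroups R H).
Proof.
move=> /unitary_semigroups_dense Udense.
exists (@unitary_semigroups R H) => //; exists almost_unitary.
  move=> m; split; first exact: open_almost_unitary.
  move=> O O0 oO; have [T [OT TU]] := Udense O O0 oO.
  by exists T; split=> //; exact: unitary_almost_unitary.
by rewrite bigcap_almost_unitary.
Qed.

End Residual.

(** * Limits of strongly Cauchy sequences of semigroups *)

Section StrongLimit.
Variables (R : realType) (H : hilbertType R).
Local Notation X := (contractive_semigroup H).
Variable S : nat -> X.
Hypothesis S_cauchy : forall (x : H) (a e : R), 0 < e -> exists N,
  forall m n, (N <= m)%N -> (N <= n)%N -> forall t, set_val t <= a ->
    rnorm (set_val (S m) t x - set_val (S n) t x) < e.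

Definition strong_limit (t : Rplus R) (x : H) : H :=
  lim ((fun n => set_val (S n) t x) @ \oo).

Lemma strong_limit_cvg t x : (fun n => set_val (S n) t x) @ \oo --> strong_limit t x.
Proof.
suff : cvg ((fun n => set_val (S n) t x) @ \oo) by [].
apply: cauchy_rnorm_cvg => e e0; have [N SN] := S_cauchy x (set_val t) e0.
by exists N => n Nn; exact: SN.
Qed.

Lemma strong_limit_unif x (a e : R) : 0 < e -> exists N, forall n, (N <= n)%N ->
  forall t, set_val t <= a -> rnorm (set_val (S n) t x - strong_limit t x) < e.
Proof.
move=> e0; have [|N SN] := S_cauchy x a (e := e / 2); first by rewrite divr_gt0.
exists N => n Nn t ta.
have /cvg_rnormP/(_ (e / 2))/(_ _)[|M _ SM] := @strong_limit_cvg t x.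
  by rewrite divr_gt0.
apply: le_lt_trans (rnorm_dist (set_val (S (maxn N M)) t x) _ _) _.
rewrite [ltRHS]splitr; apply: ltrD; first by rewrite SN ?leq_maxl.
by apply: SM; rewrite /= leq_maxr.
Qed.

Lemma strong_limit_eq t x y :
  (forall e : R, 0 < e -> exists N, forall n, (N <= n)%N ->
     rnorm (set_val (S n) t x - y) < e) -> strong_limit t x = y.
Proof.
move=> Sy; apply/eqP; rewrite -subr_eq0 -rnorm_eq0 eq_le rnorm_ge0 andbT.
apply/ler_addgt0Pl => e e0; rewrite addr0.
have [|N SN] := Sy (e / 2); first by rewrite divr_gt0.
have [|M SM] := strong_limit_unif x (set_val t) (e := e / 2); first by rewrite divr_gt0.
apply: le_trans (rnorm_dist (set_val (S (maxn N M)) t x) _ _) _.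
rewrite [leRHS]splitr; apply: lerD; apply: ltW; last by rewrite SN ?leq_maxl.
by rewrite rnormB SM ?leq_maxr.
Qed.

Lemma strong_limit_C0 : contractive_C0 strong_limit.
Proof.
have SC0 n := semigroup_C0 (S n).
apply: contractive_C0_intro.
- move=> t t0 a x y; apply: cvg_lim; first exact: norm_hausdorff.
  rewrite [X in X @ _ --> _](_ : _ = fun n =>
    a *: set_val (S n) (rp t) x + set_val (S n) (rp t) y).
    by apply: cvgD; [apply: cvgZl_tmp |]; exact: strong_limit_cvg.
  by apply/funext => n; exact: C0_linear.
- move=> t x t0; apply/ler_addgt0Pr => e e0.
  have [N SN] := strong_limit_unif x t e0.
  have := SN N (leqnn N) (rp t); rewrite set_val_rp // => /(_ (lexx _)).
  have := rnorm_dist (set_val (S N) (rp t) x) (strong_limit (rp t) x) 0.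
  rewrite !subr0 (rnormB (strong_limit _ _)); have := C0_rnorm (SC0 N) t x; lra.
- move=> x; apply: strong_limit_eq => e e0; exists 0%N => n _.
  by rewrite C0_0 // subrr rnorm0.
- move=> s t x s0 t0; apply: strong_limit_eq => e e0.
  have e20 : 0 < e / 2 by rewrite divr_gt0.
  have [N SN] := strong_limit_unif x t e20.
  have [M SM] := strong_limit_unif (strong_limit (rp t) x) s e20.
  exists (maxn N M) => n; rewrite geq_max => /andP[Nn Mn]; rewrite C0D //.
  apply: le_lt_trans (rnorm_dist (set_val (S n) (rp s) (strong_limit (rp t) x)) _ _) _.
  rewrite [ltRHS]splitr; apply: ltrD; last by rewrite SM ?set_val_rp.
  by rewrite -C0B //; apply: le_lt_trans (C0_rnorm _ _ _) _; rewrite ?SN ?set_val_rp.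
move=> x e e0; have e20 : 0 < e / 2 by rewrite divr_gt0.
(* Uniformity on times up to 1 transfers continuity at 0 from a single [S N] to the limit. *)
have [N SN] := strong_limit_unif x 1 e20.
have [h h0 hS] := C0_continuous0 (SC0 N) x e20.
exists (Num.min h 1); first by rewrite lt_min h0 ltr01.
move=> t t0; rewrite le_min => /andP[th t1].
apply: le_lt_trans (rnorm_dist (set_val (S N) (rp t) x) _ _) _.
rewrite [ltRHS]splitr; apply: ltrD; last exact: hS.
by rewrite rnormB SN // set_val_rp.
Qed.

Definition limit_semigroup : X := exist _ strong_limit (mem_set strong_limit_C0).

Lemma cvg_limit_semigroup : S @ \oo --> limit_semigroup.
Proof.
apply/cvg_semigroupP => x y a e e0.
have y0 : 0 < rnorm y + 1 by rewrite ltr_wpDl // rnorm_ge0.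
have [|N SN] := strong_limit_unif x a (e := e / (rnorm y + 1)).
  by rewrite divr_gt0.
exists N => // n Nn t ta; apply: le_lt_trans (cauchy_schwarz _ _) _.
have := SN n Nn t ta; rewrite ltr_pdivlMr // => /(le_lt_trans _); apply.
by rewrite ler_wpM2l ?rnorm_ge0 // lerDl.
Qed.

End StrongLimit.

(** * The Baire argument *)

Section SecondCategory.
Variables (R : realType) (H : hilbertType R) (d : nat -> H).
Hypothesis d_dense : forall x (e : R), 0 < e -> exists n, rnorm (x - d n) < e.
Hypothesis Hinf : ~ finite_dimensional H.
Local Notation X := (contractive_semigroup H).

(** Density is used twice: first to make [A] meet [almost_unitary d n], then to find a unitary [T]
    in the part of this open set outside [F]. Around such a [T], [strong_nbhs] gives strong control
    and regularity gives the closure inclusion. *)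
Lemma baire_step (n : nat) (F A : set X) : closed F -> interior F = set0 ->
  open A -> A !=set0 -> exists B : set X,
  [/\ open B, B !=set0, closure B `<=` A `&` almost_unitary d n `&` ~` F &
   forall S S', B S -> B S' -> forall j : 'I_n.+1, forall t, set_val t <= n%:R ->
     rnorm (set_val S t (d j) - set_val S' t (d j)) < n.+1%:R^-1].
Proof.
move=> cF F0 oA A0; have Udense := unitary_semigroups_dense Hinf.
have [T0 [AT0 UT0]] := Udense A A0 oA.
pose O := A `&` almost_unitary d n.
have oO : open O by apply: openI => //; exact: open_almost_unitary.
have OT0 : O T0 by split=> //; exact: unitary_almost_unitary.
have oOF : open (O `&` ~` F) by apply: openI => //; exact: closed_openC.
have [|T [OFT UT]] := Udense (O `&` ~` F) _ oOF.
  apply: contrapT => h; suff : interior F T0 by rewrite F0.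
  apply: filterS (open_nbhs_nbhs (conj oO OT0)) => S OS.
  by apply: contrapT => FS; apply: h; exists S.
have [V VT VO] := semigroup_regular (open_nbhs_nbhs (conj oOF OFT)).
have Tiso : isometric T by move=> t x; exact/unitary_rnorm/UT.
have r0 : 0 < n.+1%:R^-1 / 2 :> R by rewrite divr_gt0 ?invr_gt0.
pose W (j : 'I_n.+1) : set X := [set S : X | forall t, set_val t <= n%:R ->
  rnorm (set_val S t (d j) - set_val T t (d j)) < n.+1%:R^-1 / 2].
have WT : nbhs T [set S | forall j, W j S].
  by apply: (@filter_forall X 'I_n.+1 W (nbhs T)) => j; exact: strong_nbhs.
exists (interior (V `&` [set S | forall j, W j S])); split.
- exact: open_interior.
- by exists T; apply: filterI VT WT.
- by move=> S /(closure_subset (@interior_subset _ _))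
     /(closure_subset (@subIsetl _ _ _)) /VO.
move=> S S' /interior_subset[_ WS] /interior_subset[_ WS'] j t tn.
apply: le_lt_trans (rnorm_dist (set_val T t (d j)) _ _) _.
by rewrite [ltRHS]splitr; apply: ltrD; [exact: WS|rewrite rnormB; exact: WS'].
Qed.

Lemma unitary_semigroups_second_category :
  second_category (@unitary_semigroups R H).
Proof.
move=> [F cF UF].
(* Packing openness and nonemptiness into the type lets [choice] turn the step into a function that
   can be iterated. *)
pose P := {A : set X | open A /\ A !=set0}.
have step n (A : P) : exists B : P,
    closure (sval B) `<=` sval A `&` almost_unitary d n `&` ~` F n /\
    forall S S', sval B S -> sval B S' -> forall j : 'I_n.+1,
      forall t, set_val t <= n%:R ->
      rnorm (set_val S t (d j) - set_val S' t (d j)) < n.+1%:R^-1.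
  case: A => A [oA A0]; have [cFn Fn0] := cF n.
  have [B [oB B0 BA BS]] := baire_step n cFn Fn0 oA A0.
  by exists (exist _ B (conj oB B0)).
have [f fP] := choice (fun nA : nat * P => step nA.1 nA.2).
have id_C0 : contractive_C0 (fun _ : Rplus R => @id H).
  apply: contractive_C0_intro => // x e e0; exists 1 => // t _ _.
  by rewrite subrr rnorm0.
have XT : open [set: X] /\ [set: X] !=set0.
  by split; [exact: openT | exists (exist _ (fun=> id) (mem_set id_C0) : X)].
pose A := fix A n : P := if n is n'.+1 then f (n', A n') else exist _ _ XT.
have Anon n : exists S, sval (A n) S by have [] := svalP (A n).
have AS n : sval (A n.+1) `<=` sval (A n).
  by move=> S BS; have [/(_ S (subset_closure BS))[[]]] := fP (n, A n).
have Amono m n : (m <= n)%N -> sval (A n) `<=` sval (A m).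
  elim: n => [|n IH]; first by rewrite leqn0 => /eqP->.
  by rewrite leq_eqVlt => /orP[/eqP-> //|/IH Am]; exact: subset_trans (AS n) Am.
have [S SA] := choice (fun n => Anon n.+1).
have S_cauchy (x : H) (a e : R) : 0 < e -> exists N,
    forall m n, (N <= m)%N -> (N <= n)%N -> forall t, set_val t <= a ->
    rnorm (set_val (S m) t x - set_val (S n) t x) < e.
  move=> e0; have e30 : 0 < e / 3 by rewrite divr_gt0.
  have [j xj] := d_dense x e30.
  have [M _ Me] := near_infty_natSinv_lt (PosNum e30).
  (* [A N.+1] is produced by step [N], which controls [d j] on times up to [N] within [e / 3].
     Replacing [x] by [d j] on either side costs the other two thirds. *)
  pose N := maxn j (maxn M (Num.truncn a).+1); exists N => m n Nm Nn t ta.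
  have jN : (j < N.+1)%N by rewrite ltnS leq_maxl.
  have tN : set_val t <= N%:R.
    apply: le_trans ta (le_trans (ltW (truncnS_gt a)) _).
    by rewrite ler_nat !leq_max leqnn !orbT.
  have NM : N.+1%:R^-1 < e / 3 by apply: Me; rewrite /= !leq_max leqnn orbT.
  have SAN k : (N <= k)%N -> sval (A N.+1) (S k).
    by move=> Nk; apply: (Amono N.+1 k.+1) => //; exact: SA.
  have [_ /(_ _ _ (SAN m Nm) (SAN n Nn) (Ordinal jN) t tN)/=] := fP (N, A N).
  have close k : rnorm (set_val (S k) t x - set_val (S k) t (d j)) < e / 3.
    rewrite -(rpK t) -(C0B (semigroup_C0 (S k))).
    exact: le_lt_trans (C0_rnorm (semigroup_C0 (S k)) _ _) xj.
  have := rnorm_dist (set_val (S m) t (d j)) (set_val (S m) t x) (set_val (S n) t x).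
  have := rnorm_dist (set_val (S n) t (d j)) (set_val (S m) t (d j)) (set_val (S n) t x).
  have := close m; have := close n; rewrite (rnormB (set_val (S n) t x)).
  move: NM; move: (N.+1%:R^-1) => r; lra.
(* The tail of [S] from index [n] lies in [A n.+1]. Being in all these closures, the limit is
   unitary and avoids every [F n], against the assumed covering. *)
have clA n : closure (sval (A n.+1)) (limit_semigroup S_cauchy).
  move=> B /(@cvg_limit_semigroup _ _ _ S_cauchy)[N _ NB].
  exists (S (maxn n N)); split; last by apply: NB; rewrite /= leq_maxr.
  by apply: (Amono n.+1 (maxn n N).+1); rewrite ?ltnS ?leq_maxl.
have inA n : (almost_unitary d n `&` ~` F n) (limit_semigroup S_cauchy).
  by have [/(_ _ (clA n))[[]]] := fP (n, A n).
have [|i _ Fi] := UF (limit_semigroup S_cauchy).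
  by apply: almost_unitary_unitary d_dense _ _ => n; have [] := inA n.
by have [_] := inA i; apply.
Qed.

End SecondCategory.

Theorem corollary5p2 (R : realType) (H : hilbertType R)
  (Hsep : separable H) (Hinf : ~ finite_dimensional H) :
  residual (@unitary_semigroups R H) /\
  second_category (@unitary_semigroups R H).
Proof.
have [d d_dense] := separable_seq Hsep; split.
  exact: unitary_semigroups_residual d_dense Hinf.
exact: unitary_semigroups_second_category d_dense Hinf.
Qed.
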